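(* Let $\mathcal{A}:V(\Omega)\to V'(\Omega)$ be an operator such that, for every $\lambda\in\mathfrak{L}$, the restriction $\mathcal{A}|_{V_\lambda(\Omega)}$ is locally Lipschitz continuous. Let $I=[0,T)$ and let $u_0\in V_\Lambda(\Omega)$. Then there exists a number $T_\Lambda(u_0)\in(0,T]_{\mathbb{R}^*}$ such that the Cauchy problem $\partial_t u=\mathcal{A}(u)$, $u(0)=u_0$ has a unique generalized ultrafunction solution (GUS) $u_\Lambda$ in $[0,T_\Lambda(u_0))_{\mathbb{R}^*}$.
   Context: Nonstandard setting. $V_\infty(\mathbb{R})=\bigcup_n V_n(\mathbb{R})$ is the superstructure on $\mathbb{R}$ ($V_0=\mathbb{R}$, $V_{n+1}=V_n\cup\mathcal{P}(V_n)$), $\mathfrak{L}$ is the set of finite subsets of $V_\infty(\mathbb{R})$ ordered by inclusion, and $\mathcal{U}$ is a fine ultrafilter on $\mathfrak{L}$ (i.e. $\{\mu\in\mathfrak{L}:\lambda\subseteq\mu\}\in\mathcal{U}$ for every $\lambda\in\mathfrak{L}$). $\mathbb{R}^*=\mathbb{R}^{\mathfrak{L}}/\mathcal{U}$, and for a net $\varphi:\mathfrak{L}\to\mathbb{R}$, $\lim_{\lambda\uparrow\Lambda}\varphi(\lambda)$ is its class in $\mathbb{R}^*$. For nets $\varphi:\mathfrak{L}\to V_n(\mathbb{R})$, inductively $\lim_{\lambda\uparrow\Lambda}\varphi(\lambda)=\{\lim_{\lambda\uparrow\Lambda}\psi(\lambda): \psi(\lambda)\in\varphi(\lambda)\ \forall\lambda\}$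 (functions are identified with their graphs). $E^*$, $f^*$ denote the natural extensions (limits of constant nets) of sets and functions; integrals of internal functions are natural extensions of the Lebesgue integral. For $a<b$ in $\mathbb{R}^*$, $(a,b]_{\mathbb{R}^*}$ etc. denote intervals in $\mathbb{R}^*$. Ultrafunctions. $\Omega\subset\mathbb{R}^N$ and $V(\Omega)$ is a function vector space with $\mathscr{D}(\Omega)\subseteq V(\Omega)\subseteq L^2(\Omega)$; $V'(\Omega)$ is its topological dual. An approximating net for $V(\Omega)$ is a family $(V_\lambda(\Omega))_{\lambda\in\mathfrak{L}}$ of finite dimensional subspaces of $V(\Omega)$ with $V_{\lambda_1}(\Omega)\subseteq V_{\lambda_2}(\Omega)$ whenever $\lambda_1\subseteq\lambda_2$, and such that each finite dimensional subspace of $V(\Omega)$ is contained in some $V_\lambda(\Omega)$. Fix one; the space of ultrafunctions it generates is $V_\Lambda(\Omega)=\lim_{\lambda\uparrow\Lambda}V_\lambda(\Omega)=\{\lim_{\lambda\uparrow\Lambda}f_\lambda: f_\lambda\in V_\lambda(\Omega)\ \forall\lambda\}\subseteq V(\Omega)^*$. GUS. For $k\in\mathbb{N}$, $\mathcal{C}^k(I^*,V_\Lambda(\Omega))$ is the set of $u\in[\mathcal{C}^k(I,V(\Omega))]^*$ such that $\partial_t^i u(t,\cdot)\in V_\Lambda(\Omega)$ for all $t\in I^*$ and $i\le k$ (analogously for an interval $[0,S)_{\mathbb{R}^*}$ with $S\in\mathbb{R}^*$, $0<S\le T$, in place of $I^*$). A GUS of the Cauchy problem $\partial_tu=\mathcal{A}(u)$,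 $u(0)=u_0$ is a $u\in\mathcal{C}^1(I^*,V_\Lambda(\Omega))$ (resp. on $[0,S)_{\mathbb{R}^*}$) such that $\int\partial_tu\,v\,dx=\int\mathcal{A}^*(u)\,v\,dx$ for all $v\in V_\Lambda(\Omega)$ and all times $t$, and $u(0,x)=u_0(x)$; here $\int\mathcal{A}^*(u)v\,dx$ denotes the (extended) duality pairing between $V'(\Omega)$ and $V(\Omega)$. A standard $u_0\in V(\Omega)$ is identified with $u_0^*\in V_\Lambda(\Omega)$. *)

(* Defs.v *)
From HB Require Import structures.
From mathcomp Require Import all_boot all_order all_algebra finmap.
From mathcomp Require Import all_classical all_reals all_analysis.

Set Implicit Arguments.
Unset Strict Implicit.
Unset Printing Implicit Defensive.

Import Order.TTheory GRing.Theory Num.Theory.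
Import numFieldTopology.Exports numFieldNormedType.Exports.

Local Open Scope classical_set_scope.
Local Open Scope ring_scope.

Section superstructure.
Variable R : realType.

(* Reals are atoms and P(V_m) is included in P(V_n) for m <= n, so
   V_(n+1) = V_n `|` P(V_n) is the disjoint union of R and P(V_n), with V_n
   included in V_(n+1) along [superstr_up]. *)
Fixpoint superstr (n : nat) : Type :=
  if n is m.+1 then (R + set (superstr m))%type else R.

Fixpoint superstr_up (n : nat) : superstr n -> superstr n.+1 :=
  match n return superstr n -> superstr n.+1 with
  | 0 => fun r => inl r
  | m.+1 => fun x => match x with
                     | inl r => inl r
                     | inr A => inr [set superstr_up y | y in A]
                     end
  end.

(* x : V_n does not already belong to V_(n-1) *)
Definition superstr_new (n : nat) : superstr n -> Prop :=
  match n return superstr n -> Prop with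
  | 0 => fun _ => True
  | m.+1 => fun x => ~ range (@superstr_up m) x
  end.

(* The union of the V_n: each element is recorded at the least level where it
   occurs, so that Leibniz equality is equality in the union. *)
Definition superstructure : Type :=
  {n : nat & {x : superstr n | superstr_new x}}.

HB.instance Definition _ := gen_eqMixin superstructure.
HB.instance Definition _ := gen_choiceMixin superstructure.

Definition Lindex : Type := {fset superstructure}.

Definition fine_filter (U : set_system Lindex) : Prop :=
  forall l : Lindex, U [set m : Lindex | (l `<=` m)%fset].

End superstructure.

Section ultrapower.
Variables (L : Type) (U : set_system L).

Definition net_class (X : Type) (phi : L -> X) : set (L -> X) :=
  [set psi | \forall l \near U, phi l = psi l].

Definition star (X : Type) : Type :=
  {C : set (L -> X) | exists phi, C = net_class phi}.

Definition ulim (X : Type) (phi : L -> X) : star X :=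
  exist _ (net_class phi) (ex_intro _ phi erefl).

Definition net_of (X : Type) (x : star X) : L -> X := projT1 (cid (proj2_sig x)).

Definition std (X : Type) (x : X) : star X := ulim (fun=> x).

Definition ulim_set (X : Type) (A : L -> set X) : set (star X) :=
  [set x | exists2 psi : L -> X, (forall l, A l (psi l)) & x = ulim psi].

(* A relation is extended as the limit of the constant net equal to its graph,
   pairs of limits being limits of pairs; likewise for functions. *)
Definition star_rel (X Y : Type) (r : X -> Y -> Prop)
    (x : star X) (y : star Y) : Prop :=
  exists phi psi, [/\ x = ulim phi, y = ulim psi & forall l, r (phi l) (psi l)].

Definition star1 (X Y : Type) (f : X -> Y) (x : star X) : star Y :=
  ulim (fun l => f (net_of x l)).

Definition star2 (X Y Z : Type) (f : X -> Y -> Z) (x : star X) (y : star Y) :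
    star Z :=
  ulim (fun l => f (net_of x l) (net_of y l)).

Lemma net_ofK (X : Type) (x : star X) : ulim (net_of x) = x.
Proof. by rewrite /net_of; case: x => C hC; case: cid => phi /= eC; exact: eq_exist. Qed.

Hypothesis FU : Filter U.

Lemma ulimP (X : Type) (phi psi : L -> X) :
  ulim phi = ulim psi <-> \forall l \near U, phi l = psi l.
Proof.
split=> [[] /(congr1 (fun C : set _ => C psi)) /= e|e].
  suff : net_class phi psi by [].
  by rewrite e; apply: filterE.
apply: eq_exist; apply/seteqP; split=> chi /=;
  by apply: filterS2 e => l ->.
Qed.

Lemma star1E (X Y : Type) (f : X -> Y) (phi : L -> X) :
  star1 f (ulim phi) = ulim (f \o phi).
Proof.
apply/ulimP; have /ulimP := net_ofK (ulim phi).
by apply: filterS => l /= ->.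
Qed.

Lemma star2E (X Y Z : Type) (f : X -> Y -> Z) (phi : L -> X) (psi : L -> Y) :
  star2 f (ulim phi) (ulim psi) = ulim (fun l => f (phi l) (psi l)).
Proof.
apply/ulimP; have /ulimP := net_ofK (ulim phi).
have /ulimP := net_ofK (ulim psi).
by apply: filterS2 => l /= -> ->.
Qed.

End ultrapower.

Arguments ulim_set {L} U {X} A.

Notation "x <=* y" := (star_rel (fun a b => is_true (a <= b)%R) x y)
  (at level 70, no associativity).
Notation "x <* y" := (star_rel (fun a b => is_true (a < b)%R) x y)
  (at level 70, no associativity).

Section row_measurable.
Variables (R : realType) (n : nat).

Let coors : 'I_n -> 'rV[R]_n -> R := fun i x => x ord0 i.

Let rV_set0 : g_sigma_preimage coors set0.
Proof. exact: sigma_algebra0. Qed.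

Let rV_setC A : g_sigma_preimage coors A -> g_sigma_preimage coors (~` A).
Proof. exact: sigma_algebraC. Qed.

Let rV_bigcup (F : (set 'rV[R]_n)^nat) : (forall i, g_sigma_preimage coors (F i)) ->
  g_sigma_preimage coors (\bigcup_i (F i)).
Proof. exact: sigma_algebra_bigcup. Qed.

(* The product sigma-algebra, which is the Borel one. *)
HB.instance Definition _ :=
  @isMeasurable.Build default_measure_display 'rV[R]_n
    (g_sigma_preimage coors) rV_set0 rV_setC rV_bigcup.

End row_measurable.

Lemma measurable_fun_rVP (R : realType) (n : nat) d (T : measurableType d)
    (f : T -> 'rV[R]_n) :
  measurable_fun [set: T] f <->
  forall i, measurable_fun [set: T] (fun x => f x ord0 i).
Proof.
split=> [mf i|mf].
  apply: (measurableT_comp (f := fun v : 'rV[R]_n => v ord0 i)) => //.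
  move=> _ Y mY; rewrite setTI; apply: sub_sigma_algebra => /=.
  by rewrite -bigcup_seq/=; exists i; [exact: mem_index_enum|exists Y; rewrite ?setTI].
have : g_sigma_preimage (fun i x => f x ord0 i) `<=` measurable.
  apply: smallest_sub; first exact: sigma_algebra_measurable.
  rewrite -bigcup_seq/=; apply: bigcup_sub => i _ A [B mB <-].
  exact: mf.
rewrite (g_sigma_preimage_comp (fun i (v : 'rV[R]_n) => v ord0 i) f) => h.
by move=> _ A mA; apply: h; exists A.
Qed.

Section lebesgue_measure_rV.
Variable R : realType.

Definition cons_rV (n : nat) (p : measurableTypeR R * 'rV[R]_n) : 'rV[R]_n.+1 :=
  @row_mx R 1 1 n (const_mx p.1) p.2.

Lemma measurable_cons_rV (n : nat) : measurable_fun setT (@cons_rV n).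
Proof.
apply/measurable_fun_rVP => i.
have [j ->|j ->] := @split_ordP 1 n i.
  have h p : @cons_rV n p ord0 (lshift n j) = p.1.
    by rewrite /cons_rV (@row_mxEl _ 1 1 n) mxE.
  by under eq_fun do rewrite h; exact: measurable_fst.
have h p : @cons_rV n p ord0 (rshift 1 j) = p.2 ord0 j.
  by rewrite /cons_rV (@row_mxEr _ 1 1 n).
under eq_fun do rewrite h.
apply: (measurableT_comp (f := fun v : 'rV[R]_n => v ord0 j)); last exact: measurable_snd.
by apply: (measurable_fun_rVP (@id 'rV[R]_n)).1; exact: measurable_id.
Qed.

Section step.
Variables (n : nat) (mu : {sigma_finite_measure set 'rV[R]_n -> \bar R}).

Definition lebesgue_rV_step : set 'rV[R]_n.+1 -> \bar R :=
  pushforward (lebesgue_measure \x mu)%E (@cons_rV n).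

HB.instance Definition _ := Measure.copy lebesgue_rV_step
  (measure_function_pushforward__canonical__measure_function_Measure
    (lebesgue_measure \x mu)%E (@measurable_cons_rV n)).

Let lebesgue_rV_step_sigma_finite : sigma_finite setT lebesgue_rV_step.
Proof.
have [F FT mF] : sigma_finite setT (@lebesgue_measure R \x mu)%E.
  have /sigma_finiteP[F [TF ndF Foo]] := @sigma_finiteT _ _ _ (@lebesgue_measure R).
  have /sigma_finiteP[G [TG ndG Goo]] := sigma_finiteT mu.
  exists (fun n => F n `*` G n).
    rewrite -setXTT TF TG predeqE => -[x y]; split.
      move=> [/= [k _ Fkx] [l _ Gly]]; exists (maxn k l) => //; split.
      - by move: x Fkx; exact/subsetPset/ndF/leq_maxl.
      - by move: y Gly; exact/subsetPset/ndG/leq_maxr.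
    by move=> [k _ []/= ? ?]; split; exists k.
  move=> k; have [? ?] := Foo k; have [? ?] := Goo k.
  split; first exact: measurableX.
  by rewrite product_measure1E// lte_mul_pinfty// ge0_fin_numE.
pose g (v : 'rV[R]_n.+1) : measurableTypeR R * 'rV[R]_n :=
  (@lsubmx R 1 1 n v ord0 ord0, @rsubmx R 1 1 n v).
have gK : cancel (@cons_rV n) g.
  by case=> x v; rewrite /g /cons_rV row_mxKl row_mxKr mxE.
have mg : measurable_fun setT g.
  have mid := (measurable_fun_rVP (@id 'rV[R]_n.+1)).1 (@measurable_id _ _ _).
  apply/measurable_fun_pairP; split.
    rewrite (_ : fst \o g = fun v => v ord0 (@lshift 1 n ord0)); first exact: mid.
    by apply/funext => v; rewrite /g/= mxE.
  apply/measurable_fun_rVP => j.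
  have h v : (snd \o g) v ord0 j = v ord0 (@rshift 1 n j) by rewrite /g/= mxE.
  by under eq_fun do rewrite h; exact: mid.
exists (fun i => g @^-1` F i); first by rewrite -preimage_bigcup -FT.
move=> i; have [mFi Fioo] := mF i; split.
  by rewrite -[X in measurable X]setTI; exact: mg.
rewrite /lebesgue_rV_step /pushforward -comp_preimage.
by rewrite (_ : g \o _ = id) //; apply/funext => p /=; rewrite gK.
Qed.

HB.instance Definition _ :=
  Measure_isSigmaFinite.Build _ _ _ lebesgue_rV_step lebesgue_rV_step_sigma_finite.

End step.

Fixpoint lebesgue_rV (n : nat) : {sigma_finite_measure set 'rV[R]_n -> \bar R} :=
  match n with
  | 0 => dirac (0 : 'rV[R]_0)
  | m.+1 => lebesgue_rV_step (lebesgue_rV m)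
  end.

End lebesgue_measure_rV.

Section test_functions.
Variables (R : realType) (N : nat).

Definition smooth (f : 'rV[R]_N -> R) : Prop :=
  forall s : seq 'I_N,
    let g := foldr (fun i h => 'D_(delta_mx 0 i) h) (f : _ -> R^o) s in
    continuous g /\ forall x i, derivable g x (delta_mx 0 i).

Definition test_function (Omega : set 'rV[R]_N) (f : 'rV[R]_N -> R) : Prop :=
  let supp := closure [set x | f x != 0] in
  [/\ smooth f, compact supp & supp `<=` Omega].

End test_functions.

Section function_spaces.
Variables (R : realType) (N : nat) (Omega : set 'rV[R]_N).
Hypothesis mOmega : measurable Omega.

(* Lebesgue measure of R^N restricted to Omega: a.e. statements and integrals
   with respect to it only involve the values on Omega. *)
Definition lebesgue_on : {measure set 'rV[R]_N -> \bar R} :=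
  mrestr (lebesgue_rV R N) mOmega.

Definition L2 : Type := LspaceType2 lebesgue_on.

Definition L2_dot (f g : L2) : R := (\int[lebesgue_on]_x (f x * g x))%R.

(* The inclusion of V(Omega) in L^2(Omega) is the map j, the type V carrying
   the vector space structure and the topology of V(Omega). *)
Record function_space (V : tvsType R) (j : V -> L2) : Prop := FunctionSpace {
  function_space_hausdorff : hausdorff_space V ;
  function_space_inj : injective j ;
  function_space_linear : forall (a : R) (u v : V),
    {ae lebesgue_on, forall x, j (a *: u + v) x = a * j u x + j v x} ;
  function_space_test : forall f, test_function Omega f ->
    exists u : V, {ae lebesgue_on, forall x, j u x = f x} }.

End function_spaces.

Section topological_dual.
Variables (R : realType) (V : tvsType R).

Definition tdual : Type := {phi : {linear V -> R^o} | continuous phi}.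

Definition pairing (phi : tdual) (v : V) : R := proj1_sig phi v.

Definition tvs_bounded (B : set V) : Prop :=
  forall W, nbhs (0 : V) W -> exists2 r : R, 0 < r & B `<=` [set r *: x | x in W].

Definition continuous_seminorm (q : V -> R) : Prop :=
  [/\ forall x y, q (x + y) <= q x + q y,
      forall (a : R) x, q (a *: x) = `|a| * q x
    & continuous q].

(* tdual carries the strong topology, given by the seminorms
   phi |-> sup_(v in B) `|phi v|, B bounded.  If V is normed this is the norm
   topology and the condition is the usual one: near each point of W,
   `|A w1 - A w2| <= K * `|w1 - w2|. *)
Definition locally_lipschitz_on (W : set V) (A : V -> tdual) : Prop :=
  forall B, tvs_bounded B -> forall w, W w ->
  exists O q, [/\ nbhs w O, continuous_seminorm q &
    forall w1 w2, (W `&` O) w1 -> (W `&` O) w2 -> forall v, B v ->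
      `|pairing (A w1) v - pairing (A w2) v| <= q (w1 - w2)].

Definition lspan (s : seq V) : set V :=
  [set v | exists c : 'I_(size s) -> R, v = \sum_(i < size s) c i *: s`_i].

Definition finite_dim_subspace (W : set V) : Prop := exists s, W = lspan s.

Record approximating_net (Vl : Lindex R -> set V) : Prop := ApproximatingNet {
  approximating_net_fin : forall l, finite_dim_subspace (Vl l) ;
  approximating_net_mono : forall l m, (l `<=` m)%fset -> Vl l `<=` Vl m ;
  approximating_net_cofinal : forall W, finite_dim_subspace W ->
    exists l, W `<=` Vl l }.

End topological_dual.

Section Ck.
Variables (R : realType) (V : tvsType R).
Implicit Types (s : R) (u : R -> V).

(* One-sided at 0. *)
Definition diff_quotient s u (t : R) : set_system V :=
  (h^-1 *: (u (t + h) - u t)) @[h --> within [set h | 0 <= t + h < s] 0^'].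

Definition derivable_on s u : Prop :=
  forall t, 0 <= t < s -> exists d : V, diff_quotient s u t --> d.

Definition time_deriv s u : R -> V :=
  fun t => xget 0 [set d | diff_quotient s u t --> d].

Fixpoint C_k (k : nat) s : set (R -> V) :=
  match k with
  | 0 => [set u | {within [set t | 0 <= t < s], continuous u}]
  | m.+1 => [set u | derivable_on s u /\ C_k m s (time_deriv s u)]
  end.

End Ck.

Section GUS.
Variables (R : realType) (U : set_system (Lindex R)).
Variables (N : nat) (Omega : set 'rV[R]_N) (mOmega : measurable Omega).
Variables (V : tvsType R) (j : V -> L2 mOmega).
Variables (Vl : Lindex R -> set V) (A : V -> tdual V).

Definition ultrafunctions : set (star U V) := ulim_set U Vl.

Definition star_co (S : star U R) : set (star U R) :=
  [set t | std U 0 <=* t /\ t <* S].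

(* Internal functions [0, S[ -> V^* are limits of nets of functions
   [0, s_l[ -> V, with S the limit of s_l.  The functions on [0, s_l[ are
   represented by total ones, so that only the values [star_app u t] with
   t in [star_co S] are meaningful. *)
Definition star_app (u : star U (R -> V)) (t : star U R) : star U V :=
  star2 (fun f x => f x) u t.

Definition star_C_k (k : nat) (S : star U R) : set (star U (R -> V)) :=
  [set u | exists2 s, S = ulim U s & ulim_set U (fun l => C_k k (s l)) u].

Definition star_time_deriv (i : nat) (S : star U R) (u : star U (R -> V)) :
    star U (R -> V) :=
  star2 (fun s f => iter i (time_deriv s) f) S u.

Definition C_k_ultra (k : nat) (S : star U R) : set (star U (R -> V)) :=
  [set u | star_C_k k S u /\ forall i t, (i <= k)%N -> star_co S t ->
    ultrafunctions (star_app (star_time_deriv i S u) t)].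

Definition star_dot (u v : star U V) : star U R :=
  star2 (fun x y => L2_dot (j x) (j y)) u v.

Definition star_pairing (phi : star U (tdual V)) (v : star U V) : star U R :=
  star2 (@pairing R V) phi v.

Definition is_GUS (u0 : star U V) (S : star U R) (u : star U (R -> V)) : Prop :=
  [/\ C_k_ultra 1 S u,
      forall v t, ultrafunctions v -> star_co S t ->
        star_dot (star_app (star_time_deriv 1 S u) t) v =
        star_pairing (star1 A (star_app u t)) v
    & star_app u (std U 0) = u0].

End GUS.

Arguments ultrafunctions {R} U {V} Vl.

(* Main.v *)
Require Import Defs.
From mathcomp Require Import all_boot all_order all_algebra finmap.
From mathcomp Require Import all_classical all_reals all_analysis.
From mathcomp Require Import measurable_realfun ring lra.

Set Implicit Arguments.
Unset Strict Implicit.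
Unset Printing Implicit Defensive.

Import Order.TTheory GRing.Theory Num.Theory.
Import numFieldTopology.Exports numFieldNormedType.Exports.

Local Open Scope classical_set_scope.
Local Open Scope ring_scope.

(** In coordinates with respect to a basis of V_lambda, the inner product of
    L^2 turns the weak equation into an autonomous system c' = F(c), since the
    Gram matrix of the basis is invertible.  V_lambda carries its Euclidean
    topology (V is Hausdorff), so F is locally Lipschitz and derivatives in V
    are derivatives of coordinates: Picard's theorem yields s_lambda in (0, T]
    and a solution u_lambda on [0, s_lambda), unique on that same interval.
    The GUS is the Lambda-limit of the u_lambda, on [0, lim s_lambda).
    Conversely, a GUS on this interval is the limit of a net that solves the
    Galerkin problem for almost every lambda, for otherwise times and test
    vectors where it fails could be chosen, and their limits would contradict
    the equation; uniqueness thus descends from each lambda. *)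

(** * Differential equations in R^n *)

Section row_norm.
Variables (R : realType) (n : nat).
Implicit Types (x : 'rV[R]_n) (M : R).

Lemma rV_normE x : `|x| = \big[Num.max/0]_ij `|x ij.1 ij.2|.
Proof. exact: mx_normrE. Qed.

Lemma coord_le_rV_norm x i : `|x 0 i| <= `|x|.
Proof.
rewrite rV_normE.
by have := @le_bigmax _ _ _ 0 (fun ij : 'I_1 * 'I_n => `|x ij.1 ij.2|) (0, i).
Qed.

Lemma rV_norm_le x M : 0 <= M -> (forall i, `|x 0 i| <= M) -> `|x| <= M.
Proof.
by move=> M0 xM; rewrite rV_normE; apply: bigmax_le => // -[i k] _ /=; rewrite ord1.
Qed.

End row_norm.

(** * Difference quotients in normed spaces *)

Section diff_quotient_normed.
Variables (R : realType) (W : normedModType R).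
Implicit Types (s t : R) (c : R -> W) (d : W).

(** Multiplying by [h] removes the inverse. The punctured filter excludes [h = 0], but there both
    sides of the inequality vanish, so no side condition on [h] is left. *)
Lemma diff_quotient_epsP s c t d :
  diff_quotient s c t --> d <->
  forall e, 0 < e -> exists2 r, 0 < r & forall h, `|h| < r -> 0 <= t + h < s ->
    `|c (t + h) - c t - h *: d| <= e * `|h|.
Proof.
have dqE h : h != 0 ->
    `|c (t + h) - c t - h *: d| = `|h| * `|d - h^-1 *: (c (t + h) - c t)|.
  move=> h0; rewrite -normrZ scalerBr scalerA divff// scale1r -normrN opprB.
  by congr (`|_|).
split.
- move=> /cvgrPdist_le cd e e0.
  have := cd e e0; rewrite near_withinE.
  move=> /nbhs_ballP[r /= r0 rb]; exists r => // h hr hs.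
  have [->|h0] := eqVneq h 0.
    by rewrite addr0 subrr scale0r subrr !normr0 mulr0.
  rewrite dqE// mulrC ler_wpM2r//; apply: (rb h) => //.
  by rewrite /ball/= sub0r normrN.
- move=> H; apply/cvgrPdist_le => e e0; have [r r0 rP] := H e e0.
  rewrite near_withinE.
  apply/nbhs_ballP; exists r => //= h; rewrite /ball/= sub0r normrN => hr h0 hs.
  by have := rP h hr hs; rewrite dqE// mulrC ler_pM2r// ?normr_gt0.
Qed.

(** The expansion with error [1 * |h|] bounds the increment of [c] by [(1 + |d|) * |h|], which
    explains the radius chosen. *)
Lemma diff_quotient_continuous s c t d : diff_quotient s c t --> d ->
  forall e, 0 < e -> exists2 r, 0 < r & forall t', `|t' - t| < r -> 0 <= t' < s ->
    `|c t' - c t| <= e.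
Proof.
move=> /diff_quotient_epsP /(_ 1 ltr01)[r r0 rP] e e0.
have k0 : 0 < 1 + `|d| by rewrite ltr_wpDr.
exists (Num.min r (e / (1 + `|d|))) => [|t' +t's].
  by rewrite lt_min r0 divr_gt0.
rewrite lt_min => /andP[t'r t'e].
have := rP (t' - t) t'r; rewrite addrC subrK => /(_ t's) h.
have -> : c t' - c t = (c t' - c t - (t' - t) *: d) + (t' - t) *: d.
  by rewrite subrK.
rewrite (le_trans (ler_normD _ _))// normrZ (le_trans (lerD h (lexx _)))//.
rewrite mulrC -mulrDr; rewrite lter_pdivlMr// in t'e; exact: ltW.
Qed.

Lemma diff_quotientB s t c c' d d' :
  diff_quotient s c t --> d -> diff_quotient s c' t --> d' ->
  diff_quotient s (fun t => c t - c' t) t --> (d - d').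
Proof.
move=> cd cd'; apply: cvg_trans (cvgB cd cd'); apply: near_eq_cvg.
near=> h => /=; rewrite -[LHS]scalerBr; congr (_ *: _).
by rewrite !opprB addrACA [RHS]addrACA [- c t + _]addrC.
Unshelve. all: by end_near. Qed.

End diff_quotient_normed.

(** * Mean value inequality and primitives *)

Section mean_value.
Variables (R : realType) (n : nat).
Implicit Types (s t : R) (c d : R -> 'rV[R]_n).

Lemma diff_quotient_coord s c t (p : 'rV[R]_n) i :
  diff_quotient s c t --> p ->
  diff_quotient s (fun t => c t 0 i : R^o) t --> (p 0 i : R^o).
Proof.
move=> /diff_quotient_epsP cp; apply/diff_quotient_epsP => e e0.
have [r r0 rP] := cp e e0; exists r => // h hr hs.
have := coord_le_rV_norm (c (t + h) - c t - h *: p) i.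
by rewrite !mxE => /le_trans; apply; exact: rP.
Qed.

(** At an interior time the constraint [0 <= t + h < s] holds for every small [h], so the restricted
    filter is the full punctured one. *)
Lemma diff_quotient_is_derive s (f : R -> R) t (l : R) : 0 < t < s ->
  diff_quotient s (f : R -> R^o) t --> (l : R^o) -> is_derive t 1 f l.
Proof.
move=> /andP[t0 ts] fl.
suff h : h^-1 *: (f (h *: 1 + t) - f t) @[h --> 0^'] --> l.
  have dl : derivable f t 1 by apply/cvg_ex; exists l; exact: h.
  by split => //; apply/cvg_lim => //; exact: h.
apply: cvg_trans fl; rewrite /diff_quotient.
apply: (@cvg_trans _ (h^-1 *: (f (t + h) - f t) @[h --> 0^'])).
  apply: near_eq_cvg; near=> h => /=; by rewrite [h *: 1]mulr1 [t + h]addrC.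
apply: cvg_app => A A0.
have {}A0 : \forall h \near 0^', 0 <= t + h < s -> A h by exact: A0.
have : \forall h \near 0^', 0 <= t + h < s.
  apply: nbhs_dnbhs; apply/nbhs_ballP; exists (Num.min t (s - t)) => /=.
    by rewrite lt_min t0 subr_gt0.
  move=> h; rewrite /ball/= sub0r normrN lt_min !ltr_norml; lra.
by apply: filterS2 A0 => h /[swap] hs; exact.
Unshelve. all: by end_near. Qed.

Lemma diff_quotient_continuous_within s (f df : R -> R) (a b : R) :
  0 <= a -> b < s ->
  (forall t, a <= t <= b -> diff_quotient s (f : R -> R^o) t --> (df t : R^o)) ->
  {within `[a, b], continuous f}.
Proof.
move=> a0 bs fd; apply/subspace_continuousP => x /=; rewrite in_itv/= => axb.
apply/cvgrPdist_le => e e0.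
have [r r0 rP] := diff_quotient_continuous (fd x axb) e0.
rewrite near_withinE; apply/nbhs_ballP; exists r => //= y.
rewrite /ball/= distrC => yr; rewrite in_itv/= => /andP[ay yb].
by rewrite distrC rP// (le_trans a0 ay) (le_lt_trans yb).
Qed.

(** The real mean value theorem is applied to each coordinate; the intermediate point may vary with
    the coordinate, but the norm is a maximum, so the bound survives without a constant. Taking
    [p = 0] gives Lipschitz bounds, taking [p] to be the expected derivative gives
    differentiability. *)
Lemma mean_value s c d (a b M : R) (p : 'rV[R]_n) : 0 <= a <= b -> b < s ->
  (forall t, a <= t <= b -> diff_quotient s c t --> d t) ->
  (forall t, a < t < b -> `|d t - p| <= M) ->
  `|c b - c a - (b - a) *: p| <= M * (b - a).
Proof.
move=> /andP[a0]; rewrite le_eqVlt => /predU1P[->|ab] bs cd dp.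
  by rewrite !subrr scale0r subr0 normr0 mulr0.
have M0 : 0 <= M.
  by apply: le_trans (dp ((a + b) / 2) _) => //; lra.
apply: rV_norm_le => [|i]; first by rewrite mulr_ge0// subr_ge0 ltW.
have := @MVT R (fun t => c t 0 i) (fun t => d t 0 i) a b ab.
case.
- move=> x; rewrite in_itv/= => /andP[ax xb]; apply: (@diff_quotient_is_derive s).
    by rewrite (le_lt_trans a0 ax) (lt_trans xb).
  by apply: diff_quotient_coord; apply: cd; rewrite !ltW.
- apply: (@diff_quotient_continuous_within s _ (fun t => d t 0 i)) => // t atb.
  by apply: diff_quotient_coord; exact: cd.
move=> x; rewrite in_itv/= => axb e; rewrite !mxE e.
have -> : d x 0 i * (b - a) - (b - a) * p 0 i = (d x - p) 0 i * (b - a).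
  by rewrite !mxE; ring.
rewrite normrM (@gtr0_norm _ (b - a)) ?subr_gt0// ler_wpM2r ?subr_ge0 ?(ltW ab)//.
by rewrite (le_trans (coord_le_rV_norm (d x - p) i))// dp// axb.
Qed.

Lemma mean_value_sym s c d (lo hi a b M : R) (p : 'rV[R]_n) : 0 <= lo -> hi < s ->
  lo <= a <= hi -> lo <= b <= hi ->
  (forall t, lo <= t <= hi -> diff_quotient s c t --> d t) ->
  (forall t, lo <= t <= hi -> `|t - a| <= `|b - a| -> `|d t - p| <= M) ->
  `|c b - c a - (b - a) *: p| <= M * `|b - a|.
Proof.
move=> lo0 his /andP[loa ahi] /andP[lob bhi] cd dp.
have [ab|ba] := leP a b.
  rewrite ger0_norm ?subr_ge0//; apply: (@mean_value s c d) => //.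
  - by rewrite (le_trans lo0 loa).
  - exact: le_lt_trans his.
  - by move=> t /andP[? ?]; apply: cd; rewrite (le_trans loa)//= (le_trans _ bhi).
  - move=> t /andP[? ?]; apply: dp; first by lra.
    by rewrite !ger0_norm; lra.
have -> : c b - c a - (b - a) *: p = - (c a - c b - (a - b) *: p).
  by rewrite opprD opprB opprK -scaleNr opprB.
rewrite normrN (distrC b a) ger0_norm ?subr_ge0 ?(ltW ba)//.
apply: (@mean_value s c d) => //.
- by rewrite (le_trans lo0 lob)/= ltW.
- exact: le_lt_trans his.
- by move=> t /andP[? ?]; apply: cd; rewrite (le_trans lob)//= (le_trans _ ahi).
- move=> t /andP[? ?]; apply: dp; first by lra.
  by rewrite !ler0_norm; lra.
Qed.

Lemma is_derive_diff_quotient s (f : R -> R) t (l : R) :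
  is_derive t 1 f l -> diff_quotient s (f : R -> R^o) t --> (l : R^o).
Proof.
move=> [df fl]; apply: cvg_within_filter.
have : h^-1 *: (f (h *: 1 + t) - f t) @[h --> 0^'] --> l.
  by rewrite -fl; exact: df.
apply: cvg_trans; apply: near_eq_cvg; near=> h => /=.
by rewrite [h *: 1]mulr1 [t + h]addrC.
Unshelve. all: by end_near. Qed.

Lemma diff_quotient_rV s c t (p : 'rV[R]_n) :
  (forall i, diff_quotient s (fun t => c t 0 i : R^o) t --> (p 0 i : R^o)) ->
  diff_quotient s c t --> p.
Proof.
move=> cp; apply/cvgrPdist_le => e e0.
have : \forall h \near within [set h | 0 <= t + h < s] 0^', forall i,
    `|p 0 i - h^-1 *: (c (t + h) 0 i - c t 0 i)| <= e.
  by apply: filter_forall => i; have /cvgrPdist_le /(_ e e0) := cp i.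
apply: filterS => h hP; apply: rV_norm_le => [|i]; first exact: ltW.
by have := hP i; rewrite !mxE.
Qed.

(** Integrating from -1 makes 0 an interior point, so that the derivative at 0 is two-sided as well;
    subtracting the value at 0 restores the normalisation. *)
Lemma primitive (f : R -> R) : continuous f ->
  exists G : R -> R, G 0 = 0 /\ forall t, -1 < t < 1 -> is_derive t 1 G (f t).
Proof.
move=> fc.
pose G t := (\int[lebesgue_measure]_(x in `[-1, t]) f x)%R.
exists (fun t => G t - G 0); split; first by rewrite subrr.
move=> t /andP[t1 t2].
have int : lebesgue_measure.-integrable `[-1, 1] (EFin \o f).
  apply: continuous_compact_integrable; first exact: segment_compact.
  exact: continuous_subspaceT.
have [dG Gf] := continuous_FTC1_closed t2 int t1 (fc t).
have H : is_derive t 1 G (f t).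
  by rewrite -Gf derive1E; exact: derivableP.
by apply: is_derive_eq; rewrite oppr0 addr0.
Qed.

Lemma primitive_rV (f : R -> 'rV[R]_n) : continuous f ->
  exists G : R -> 'rV[R]_n, G 0 = 0 /\
    forall s t, 0 <= t < 1 -> diff_quotient s G t --> f t.
Proof.
move=> fc.
have : forall i, exists G : R -> R, G 0 = 0 /\
    forall t, -1 < t < 1 -> is_derive t 1 G (f t 0 i).
  move=> i; apply: primitive => t.
  by apply: (cvg_comp _ (fun x : 'rV[R]_n => x 0 i) (fc t)); exact: coord_continuous.
move=> /choice[G HG]; exists (fun t => \row_i G i t); split.
  by apply/rowP => i; rewrite !mxE (HG i).1.
move=> s t t01; apply: diff_quotient_rV => i; under eq_fun do rewrite mxE.
by apply: is_derive_diff_quotient; apply: (HG i).2; lra.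
Qed.

End mean_value.

(** * Geometric error terms *)

Section geometric.
Variable R : realType.

(** This is how estimates on the Picard iterates are passed to the limit: the error [C / 2 ^+ k]
    eventually drops below any positive gap [x - y], since [k < 2 ^ k]. *)
Lemma ler_geometric (x y C : R) : (forall k, x <= y + C / 2 ^+ k) -> x <= y.
Proof.
move=> H; rewrite leNgt; apply/negP => yx.
have C0 : 0 < C by have := H 0; rewrite expr0 divr1; lra.
have xy0 : 0 < (x - y) / C by rewrite divr_gt0// subr_gt0.
have [k] := @ltr_add_invr R 0 _ xy0.
rewrite add0r ltr_pdivlMr// => h.
have := H k; apply/negP; rewrite -ltNge -ltrBrDl; apply: le_lt_trans h.
rewrite mulrC ler_pM2r// lef_pV2 ?posrE ?exprn_gt0//.
by rewrite -natrX ler_nat ltn_expl.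
Qed.

(** The intervals of centre [x k] and radius [2 * C / 2 ^+ k] are nested; the limit is the supremum
    of their left ends, and it belongs to all of them. *)
Lemma geometric_limit (x : R ^nat) (C : R) :
  (forall k, `|x k.+1 - x k| <= C / 2 ^+ k) ->
  exists l, forall k, `|x k - l| <= 2 * C / 2 ^+ k.
Proof.
move=> xC.
pose y k := x k - 2 * C / 2 ^+ k; pose z k := x k + 2 * C / 2 ^+ k.
have E k : 2 * C / 2 ^+ k = 2 * (2 * C / 2 ^+ k.+1).
  by rewrite exprS invfM; field; rewrite expf_neq0.
have yS k : y k <= y k.+1.
  have := xC k; rewrite /y ler_norml => /andP[h _].
  have := E k; move: h; lra.
have zS k : z k.+1 <= z k.
  have := xC k; rewrite /z ler_norml => /andP[_ h].
  have := E k; move: h; lra.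
have C0 : 0 <= C by have := xC 0%N; rewrite expr0 divr1; apply: le_trans.
have yz k : y k <= z k.
  have : 0 <= 2 * C / 2 ^+ k by rewrite divr_ge0 ?mulr_ge0 ?exprn_ge0.
  by rewrite /y /z; lra.
have yh : {homo y : a b / (a <= b)%N >-> a <= b} by apply/nondecreasing_seqP.
have zh a b : (a <= b)%N -> z b <= z a.
  elim: b => [|b IH]; first by rewrite leqn0 => /eqP->.
  by rewrite leq_eqVlt => /predU1P[->//|/IH]; exact: le_trans.
have yz2 a b : y a <= z b.
  by rewrite (le_trans (yh _ _ (leq_maxl a b)))// (le_trans (yz _))// zh// leq_maxr.
exists (sup (range y)) => k.
have ub : has_ubound (range y) by exists (z 0%N) => _ [m _ <-].
have h1 : y k <= sup (range y) by apply: ub_le_sup => //; exists k.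
have h2 : sup (range y) <= z k.
  by apply: ge_sup; [exists (y 0%N); exists 0%N|move=> _ [m _ <-]].
by rewrite ler_norml; move: h1 h2; rewrite /y /z; lra.
Qed.

End geometric.

(** * Local existence by Picard iteration *)

Section picard.
Variables (R : realType) (n : nat).
Implicit Types (s t : R) (c d : R -> 'rV[R]_n).
Variables (F : 'rV[R]_n -> 'rV[R]_n) (a : 'rV[R]_n) (r K : R).
Hypotheses (r0 : 0 < r) (K0 : 0 <= K).
Hypothesis F_lip : forall x y, `|x - a| <= r -> `|y - a| <= r ->
  `|F x - F y| <= K * `|x - y|.

Lemma lipschitz_bound x : `|x - a| <= r -> `|F x| <= `|F a| + K * r.
Proof.
move=> xa; have aa : `|a - a| <= r by rewrite subrr normr0 ltW.
have h := F_lip xa aa.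
rewrite -(subrK (F a) (F x)) addrC (le_trans (ler_normD _ _))// lerD2l.
by rewrite (le_trans h)// ler_wpM2l.
Qed.

Let M := `|F a| + K * r.
Let M0 : 0 <= M. Proof. by rewrite addr_ge0// mulr_ge0// ltW. Qed.

(* Ensures that the iterates stay at distance at most r / 2 from a, as
   M * s <= r / 2, and that they contract, as K * s <= 1 / 2. *)
Let m := Num.min 1 (Num.min (r / (2 * (M + 1))) (2 * (K + 1))^-1).

(** Halving makes the time strictly smaller than 1, so that the closed interval [[0, s]] lies in
    [[0, 1)], where [primitive_rV] provides derivatives. *)
Definition picard_time : R := m / 2.

Let s := picard_time.

Lemma picard_time_gt0 : 0 < s.
Proof.
by rewrite divr_gt0// !lt_min ltr01 divr_gt0 ?invr_gt0 ?mulr_gt0//= ltr_wpDl.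
Qed.

Let s1 : s < 1.
Proof.
have : m <= 1 by rewrite ge_min lexx.
by rewrite /s /picard_time; lra.
Qed.

Let Ms : M * s <= r / 2.
Proof.
have h : m <= r / (2 * (M + 1)).
  by rewrite !ge_min lexx orbT.
have {h} : s <= r / (2 * (M + 1)).
  have : 0 < r / (2 * (M + 1)) by rewrite divr_gt0 ?mulr_gt0 ?ltr_wpDl.
  by rewrite /s /picard_time; lra.
rewrite ler_pdivlMr ?mulr_gt0 ?ltr_wpDl//; have := picard_time_gt0; rewrite -/s; nra.
Qed.

Let Ks : K * s <= 1 / 2.
Proof.
have h : m <= (2 * (K + 1))^-1.
  by rewrite !ge_min lexx !orbT.
have {h} : s <= 1 / (2 * (K + 1)).
  have : 0 < (2 * (K + 1))^-1 by rewrite invr_gt0 ?mulr_gt0 ?ltr_wpDl.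
  by rewrite /s /picard_time; lra.
rewrite ler_pdivlMr ?mulr_gt0 ?ltr_wpDl//; have := picard_time_gt0; rewrite -/s; nra.
Qed.

(* Freezing the time outside [0, s] makes the right-hand side of the iteration
   continuous on the whole line, as required by [primitive_rV]. *)
Let q t := Num.max 0 (Num.min t s).

Let q_itv t : 0 <= q t <= s.
Proof.
have := picard_time_gt0; rewrite -/s => s0.
by rewrite /q le_max lexx/= ge_max (ltW s0)/= ge_min lexx orbT.
Qed.

Let qE t : 0 <= t <= s -> q t = t.
Proof. by move=> /andP[t0 ts]; rewrite /q min_l// max_r. Qed.

Let q_lip t t' : `|q t' - q t| <= `|t' - t|.
Proof.
have := picard_time_gt0; rewrite -/s /q => s0.
have := ler_norm (t' - t); have := ler_norm (- (t' - t)); rewrite normrN ler_norml.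
case: (leP t s) => ?; case: (leP t' s) => ?; rewrite ?(max_r (ltW s0));
  case: (leP 0 t) => ?; case: (leP 0 t') => ?; lra.
Qed.

(** Invariant of the iteration. Derivatives refer to [[0, 1)], so they exist at the end point [s]
    too; they serve to make the next integrand continuous. *)
Let iterate_ok u := u 0 = a /\ forall t, 0 <= t <= s ->
  `|u t - a| <= r / 2 /\ exists p : 'rV[R]_n, diff_quotient 1 u t --> p.

Let iterate_continuous u : iterate_ok u -> continuous (fun t => F (u (q t))).
Proof.
move=> [ua uP] t; apply/cvgrPdist_le => e e0.
have [/= _ [d ud]] := uP _ (q_itv t).
(* Dividing by [K + 1] instead of [K] covers the case [K = 0]. *)
have e1 : 0 < e / (K + 1) by rewrite divr_gt0 ?ltr_wpDl.
have [dl dl0 dlP] := diff_quotient_continuous ud e1.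
apply/nbhs_ballP; exists dl => //= t'; rewrite /ball/= distrC => tt'.
have inb x : `|u (q x) - a| <= r.
  by rewrite (le_trans (uP _ (q_itv x)).1)//; move: r0; lra.
rewrite (le_trans (F_lip _ _))// distrC.
have h : `|u (q t') - u (q t)| <= e / (K + 1).
  apply: dlP; first exact: le_lt_trans (q_lip _ _) tt'.
  by have := s1; have := q_itv t'; lra.
rewrite ler_pdivlMr ?ltr_wpDl// in h; apply: le_trans h.
by rewrite mulrC; apply: ler_wpM2l => //; lra.
Qed.

(** The iterates [u (k+1) = a + (primitive of F (u k))] converge geometrically at each time. The
    equation for the limit [c] is not obtained by integrating: the increments of the iterates are
    estimated by the mean value inequality, and the estimate is passed to the limit. *)
Lemma picard_existence :
  exists c, c 0 = a /\ forall t, 0 <= t < s ->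
    `|c t - a| <= r / 2 /\ diff_quotient s c t --> F (c t).
Proof.
have s0 := picard_time_gt0; rewrite -/s in s0.
have /choice[P HP] : forall f : R -> 'rV[R]_n, exists G : R -> 'rV[R]_n, continuous f ->
    G 0 = 0 /\ forall s t, 0 <= t < 1 -> diff_quotient s G t --> f t.
  move=> f; have [/primitive_rV[G HG]|nf] := pselect (continuous f); first by exists G.
  by exists (cst 0).
pose step u t := a + P (fun t => F (u (q t))) t.
pose u k := iter k step (cst a).
have stepP v : iterate_ok v -> step v 0 = a /\
    forall t, 0 <= t <= s -> diff_quotient 1 (step v) t --> F (v t).
  move=> /[dup] vok /iterate_continuous /HP[P0 PG]; split; first by rewrite /step P0 addr0.
  move=> t ts; have := PG 1 t; rewrite qE//; have -> : 0 <= t < 1 by move: s1; lra.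
  move=> /(_ isT); apply: cvg_trans; apply: near_eq_cvg; near=> h.
  by rewrite /step opprD addrACA subrr add0r.
have ball2 x : `|x - a| <= r / 2 -> `|x - a| <= r by move: r0; lra.
have uok k : iterate_ok (u k).
  elim: k => [|k IH].
    split=> // t ts; rewrite /u/= subrr normr0; split; first by move: r0; lra.
    by exists 0; apply/diff_quotient_epsP => e e0; exists 1 => // h _ _;
      rewrite scaler0 !subrr normr0 mulr_ge0// ltW.
  have [n0 nd] := stepP _ IH; split => // t /andP[t0 ts]; split; last first.
    by exists (F (u k t)); apply: nd; rewrite t0.
  (* The derivative [F (u k)] is bounded by [M] on the ball, so the iterate moves by at most
     [M * s <= r / 2]. *)
  have := @mean_value _ _ 1 (u k.+1) (fun t => F (u k t)) 0 t M 0.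
  rewrite lexx t0 /= (le_lt_trans ts s1) scaler0 !subr0 n0 => /(_ isT isT) H.
  apply: (le_trans (H _ _)).
  - by move=> x xt; apply: nd; lra.
  - move=> x xt; rewrite subr0; apply: lipschitz_bound; apply: ball2.
    by apply: (IH.2 _ _).1; lra.
  - by apply: le_trans Ms; apply: ler_wpM2l.
have uball k t : 0 <= t <= s -> `|u k t - a| <= r by move=> /((uok k).2 t)[/ball2].
have ud k t : 0 <= t <= s -> diff_quotient 1 (u k.+1) t --> F (u k t).
  by move=> ts; apply: (stepP _ (uok k)).2.
(* Each further iteration gains the factor [K * s <= 1 / 2]. *)
have udist k t : 0 <= t <= s -> `|u k.+1 t - u k t| <= r / 2 ^+ k.
  elim: k t => [|k IH] t /andP[t0 ts].
    have [|h _] := (uok 1%N).2 t; first by rewrite t0.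
    by rewrite expr0 divr1 -[u 0%N t]/a ball2.
  have := @mean_value _ _ 1 (fun t => u k.+2 t - u k.+1 t)
    (fun t => F (u k.+1 t) - F (u k t)) 0 t (K * (r / 2 ^+ k)) 0.
  rewrite lexx t0 (le_lt_trans ts s1) scaler0 !subr0 => /(_ isT isT).
  cbv beta; rewrite (uok k.+2).1 (uok k.+1).1 subrr subr0 => H.
  apply: (le_trans (H _ _)).
  - move=> x xt; have xs : 0 <= x <= s by lra.
    exact: diff_quotientB (ud k.+1 x xs) (ud k x xs).
  - move=> x xt; have xs : 0 <= x <= s by lra.
    rewrite subr0 (le_trans (F_lip _ _)) ?uball//.
    by rewrite ler_wpM2l// IH.
  - have Kt : K * t <= 1 / 2 by rewrite (le_trans _ Ks)// ler_wpM2l.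
    have e0 : 0 <= r / 2 ^+ k by rewrite divr_ge0 ?exprn_ge0 ?(ltW r0).
    have -> : r / 2 ^+ k.+1 = 1 / 2 * (r / 2 ^+ k) by rewrite exprS invfM; ring.
    by rewrite mulrAC ler_wpM2r.
have ulim t : exists l, 0 <= t <= s -> forall k, `|u k t - l| <= 2 * r / 2 ^+ k.
  have [ts|] := boolP (0 <= t <= s); last by exists 0.
  have /choice[l lP] : forall i, exists l, forall k, `|u k t 0 i - l| <= 2 * r / 2 ^+ k.
    move=> i; apply: geometric_limit => k.
    apply: le_trans (udist k t ts).
    by have := coord_le_rV_norm (u k.+1 t - u k t) i; rewrite !mxE.
  exists (\row_i l i) => _ k; apply: rV_norm_le => [|i]; last by rewrite !mxE.
  by rewrite divr_ge0 ?mulr_ge0 ?(ltW r0)// exprn_ge0.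
have [c cP] := choice ulim.
have c0 : c 0 = a.
  apply/eqP; rewrite eq_sym -subr_eq0 -normr_le0; apply: (@ler_geometric _ _ _ (2 * r)) => k.
  by rewrite add0r -{1}(uok k).1; apply: cP; rewrite lexx ltW.
have cball t : 0 <= t <= s -> `|c t - a| <= r / 2.
  move=> ts; apply: (@ler_geometric _ _ _ (2 * r)) => k.
  rewrite -(subrK (u k t) (c t)) -addrA addrC (le_trans (ler_normD _ _))// lerD//.
    by have [] := (uok k).2 t ts.
  by rewrite distrC; exact: cP.
(* At each of the two times [c] is within [2 * r / 2 ^+ k] of the iterate, so an estimate on
   increments of [u k] holds for [c] up to an error that [ler_geometric] removes. *)
have cdist t t' k : 0 <= t <= s -> 0 <= t' <= s ->
    forall p, `|c t' - c t - p| <= `|u k t' - u k t - p| + 4 * r / 2 ^+ k.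
  move=> ts ts' p.
  have -> : c t' - c t - p = u k t' - u k t - p + ((u k t - c t) - (u k t' - c t')).
    apply/rowP => i; rewrite !mxE; ring.
  rewrite (le_trans (ler_normD _ _))// lerD2l (le_trans (ler_normB _ _))//.
  by have := cP t ts k; have := cP t' ts' k; lra.
(* The iterate of index [k.+1] is used because its derivative is [F (u k)], bounded by [M]. *)
have clip t t' : 0 <= t <= s -> 0 <= t' <= s -> `|c t' - c t| <= M * `|t' - t|.
  move=> ts ts'; apply: (@ler_geometric _ _ _ (4 * r)) => k.
  have := cdist t t' k.+1 ts ts' 0; rewrite !subr0 => /le_trans; apply; apply: lerD.
    have := @mean_value_sym _ _ 1 (u k.+1) (fun t => F (u k t)) 0 s t t' M 0.
    rewrite scaler0 subr0; apply => //; first exact: ud.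
    by move=> x xs _; rewrite subr0; apply: lipschitz_bound; exact: uball.
  rewrite ler_wpM2l ?mulr_ge0 ?(ltW r0)// lef_pV2 ?posrE ?exprn_gt0// exprS.
  by rewrite ler_peMl ?exprn_ge0// ler1n.
exists c; split => // t /andP[t0 /ltW ts]; split; first by apply: cball; rewrite t0.
have {t0}ts : 0 <= t <= s by rewrite t0.
apply/diff_quotient_epsP => e e0.
have KM : 0 < K * M + 1 by rewrite ltr_wpDl// mulr_ge0.
exists (e / (K * M + 1)) => [|h he]; first by rewrite divr_gt0.
move=> /andP[h0 /ltW hs]; have {h0}hs : 0 <= t + h <= s by rewrite h0.
(* The remainder turns out to be quadratic in [h], and the chosen radius gives
   [K * M * |h| <= e]. *)
apply: (@le_trans _ _ (K * M * `|h| * `|h|)); last first.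
  rewrite ler_wpM2r//; rewrite lter_pdivlMr// in he.
  by apply: le_trans (ltW he); rewrite mulrC ler_wpM2l//; lra.
apply: (@ler_geometric _ _ _ (2 * K * r * `|h| + 4 * r)) => k.
apply: le_trans (cdist t (t + h) k.+1 ts hs _) _.
(* Here [F (u k x)] is compared with [F (c t)] through [c x]: the distance from [u k x] to [c x] is
   at most [2 * r / 2 ^+ k], that from [c x] to [c t] at most [M * |h|]. *)
have := @mean_value_sym _ _ 1 (u k.+1) (fun t => F (u k t)) 0 s t (t + h)
  (K * (2 * r / 2 ^+ k + M * `|h|)) (F (c t)).
rewrite (_ : t + h - t = h); last by ring.
move=> /(_ (lexx 0) s1 ts hs (ud k)) H.
apply: (le_trans (lerD (H _) (lexx _))).
  move=> x xs xt; rewrite (le_trans (F_lip _ _)) ?uball// ?ball2 ?cball//.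
  rewrite ler_wpM2l// -(subrK (c x) (u k x)) -addrA (le_trans (ler_normD _ _))// lerD ?cP//.
  by rewrite (le_trans (clip _ _ _ _))// ler_wpM2l.
have -> : 4 * r / 2 ^+ k.+1 = 2 * r / 2 ^+ k by rewrite exprS invfM; field; rewrite expf_neq0.
have p0 : 0 <= r / 2 ^+ k by rewrite divr_ge0 ?exprn_ge0 ?(ltW r0).
have -> : (K * (2 * r / 2 ^+ k + M * `|h|)) * `|h| + 2 * r / 2 ^+ k =
  K * M * `|h| * `|h| + (2 * K * r * `|h| + 2 * r) / 2 ^+ k by ring.
by rewrite lerD2l ler_wpM2r ?invr_ge0 ?exprn_ge0// lerD2l; move: r0; lra.
Unshelve. all: by end_near. Qed.

End picard.

(** * Uniqueness for the differential equation *)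

Section uniqueness.
Variables (R : realType) (n : nat).
Variables (F : 'rV[R]_n -> 'rV[R]_n) (a : 'rV[R]_n) (r K : R).
Hypotheses (r0 : 0 < r) (K0 : 0 <= K).
Hypothesis F_lip : forall x y, `|x - a| <= r -> `|y - a| <= r ->
  `|F x - F y| <= K * `|x - y|.
Variables (s : R) (c d : R -> 'rV[R]_n).
Hypothesis cF : forall t, 0 <= t < s -> diff_quotient s c t --> F (c t).
Hypothesis dF : forall t, 0 <= t < s -> diff_quotient s d t --> F (d t).

(** Starting within [r / 2] of [a], both solutions stay in the ball of radius [r] for a time [e],
    which is also chosen with [K * e <= 1 / 2]. Each application of the mean value inequality then
    halves the bound on their distance. *)
Lemma ode_local_uniqueness t0 : 0 <= t0 < s -> c t0 = d t0 -> `|d t0 - a| <= r / 2 ->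
  exists2 e, 0 < e & forall t, t0 <= t < t0 + e -> t < s -> c t = d t.
Proof.
move=> t0s cd0 d0a; have r2 : 0 < r / 2 by rewrite divr_gt0.
have [dc dc0 cP] := diff_quotient_continuous (cF t0s) r2.
have [dd dd0 dP] := diff_quotient_continuous (dF t0s) r2.
pose e := Num.min (Num.min dc dd) (2 * (K + 1))^-1.
have e0 : 0 < e by rewrite !lt_min dc0 dd0 invr_gt0 mulr_gt0 ?ltr_wpDl.
have edc : e <= dc by rewrite !ge_min lexx.
have edd : e <= dd by rewrite !ge_min lexx orbT.
have Ke : K * e <= 1 / 2.
  have : e <= 1 / (2 * (K + 1)) by rewrite div1r ge_min lexx orbT.
  by rewrite ler_pdivlMr ?mulr_gt0 ?ltr_wpDl//; nra.
have ball f : (forall t', `|t' - t0| < e -> 0 <= t' < s -> `|f t' - f t0| <= r / 2) ->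
    `|f t0 - a| <= r / 2 -> forall t, t0 <= t < t0 + e -> t < s -> `|f t - a| <= r.
  move=> fP f0 t te ts; rewrite -(subrK (f t0) (f t)) -addrA (le_trans (ler_normD _ _))//.
  rewrite [leRHS]splitr lerD// fP//; last by lra.
  by rewrite ger0_norm; lra.
have cb := ball c (fun t' h => cP t' (lt_le_trans h edc)).
rewrite {1}cd0 in cb; have {}cb := cb d0a.
have {}db := ball d (fun t' h => dP t' (lt_le_trans h edd)) d0a.
have H k t : t0 <= t < t0 + e -> t < s -> `|c t - d t| <= 2 * r / 2 ^+ k.
  elim: k t => [|k IH] t te ts.
    rewrite expr0 divr1 -(subrK a (c t)) -addrA (le_trans (ler_normD _ _))//.
    by rewrite (distrC a); have := cb t te ts; have := db t te ts; lra.
  have := @mean_value _ _ s (fun t => c t - d t) (fun t => F (c t) - F (d t)) t0 t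
    (K * (2 * r / 2 ^+ k)) 0.
  cbv beta; rewrite cd0 scaler0 subrr !subr0 => H.
  apply: (le_trans (H _ _ _ _)) => //.
  - lra.
  - by move=> x xt; apply: diff_quotientB; [apply: cF|apply: dF]; lra.
  - move=> x xt; have xe : t0 <= x < t0 + e by lra.
    have xs : x < s by lra.
    rewrite subr0 (le_trans (F_lip _ _)) ?cb ?db//.
    by rewrite ler_wpM2l// IH.
  - have Kt : K * (t - t0) <= 1 / 2 by rewrite (le_trans _ Ke)// ler_wpM2l//; lra.
    have p0 : 0 <= 2 * r / 2 ^+ k by rewrite divr_ge0 ?exprn_ge0 ?mulr_ge0 ?(ltW r0).
    have -> : 2 * r / 2 ^+ k.+1 = 1 / 2 * (2 * r / 2 ^+ k) by rewrite exprS invfM; ring.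
    by rewrite mulrAC ler_wpM2r.
exists e => // t te ts; apply/eqP; rewrite -subr_eq0 -normr_le0.
by apply: (@ler_geometric _ _ _ (2 * r)) => k; rewrite add0r; exact: H.
Qed.

(** Continuation argument: at the supremum of the times of agreement [c] equals [d], hence lies in
    the small ball as well, and local uniqueness extends the agreement past the supremum. The
    competitor [c] is not confined to the ball beforehand. *)
Lemma ode_uniqueness : c 0 = d 0 -> (forall t, 0 <= t < s -> `|d t - a| <= r / 2) ->
  forall t, 0 <= t < s -> c t = d t.
Proof.
move=> cd0 db t1 /andP[t10 t1s]; apply: contrapT => ne.
pose E := [set t | 0 <= t < s /\ forall x, 0 <= x <= t -> c x = d x].
have E0 : E 0.
  split; first by rewrite lexx (le_lt_trans t10).
  by move=> x; rewrite -eq_le => /eqP <-.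
have Et1 t : E t -> t <= t1.
  by move=> [_ Et]; rewrite leNgt; apply/negP => /ltW h; apply: ne; apply: Et; rewrite t10.
have ubE : has_ubound E by exists t1.
pose sg := sup E.
have sg0 : 0 <= sg by exact: ub_le_sup.
have sgt1 : sg <= t1 by apply: ge_sup => //; exists 0.
have sgs : 0 <= sg < s by rewrite sg0 (le_lt_trans sgt1).
have lsg x : 0 <= x < sg -> c x = d x.
  move=> /andP[x0 xsg].
  have e0 : 0 < sg - x by rewrite subr_gt0.
  have hs : has_sup E by split => //; exists 0.
  have [y [_ Ey]] := sup_adherent e0 hs; rewrite -/sg opprB addrCA subrr addr0 => xy.
  by apply: Ey; rewrite x0 ltW.
(* By continuity from the left: at the earlier time [sg - h] the two solutions agree, and each has
   moved by at most [e / 2] since. *)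
have cdsg : c sg = d sg.
  move: sg0; rewrite le_eqVlt => /predU1P[<-//|sgt0].
  apply/eqP; rewrite -subr_eq0 -normr_le0; apply/ler_addgt0Pl => e e0.
  have e2 : 0 < e / 2 by rewrite divr_gt0.
  have [dc dc0 cP] := diff_quotient_continuous (cF sgs) e2.
  have [dd dd0 dP] := diff_quotient_continuous (dF sgs) e2.
  pose h := Num.min (Num.min dc dd) sg / 2.
  have h0 : 0 < h by rewrite divr_gt0// !lt_min dc0 dd0.
  have hlt : h < Num.min (Num.min dc dd) sg by move: h0; rewrite /h; lra.
  move: hlt; rewrite !lt_min => /andP[/andP[hc hd] hsg].
  have xs : 0 <= sg - h < s by lra.
  have nx : `|sg - h - sg| = h by rewrite addrC addKr normrN gtr0_norm.
  have := cP (sg - h); have := dP (sg - h); rewrite nx lsg; last by lra.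
  move=> /(_ hd xs) h1 /(_ hc xs) h2.
  rewrite addr0 -(subrK (d (sg - h)) (c sg)) -addrA (le_trans (ler_normD _ _))//.
  by rewrite (distrC (c sg)); lra.
have [e e0 eP] := ode_local_uniqueness sgs cdsg (db _ sgs).
pose t2 := sg + Num.min e (s - sg) / 2.
have m0 : 0 < Num.min e (s - sg) by rewrite lt_min e0 subr_gt0; case/andP: sgs.
have me : Num.min e (s - sg) <= e by rewrite ge_min lexx.
have ms : Num.min e (s - sg) <= s - sg by rewrite ge_min lexx orbT.
have : E t2.
  split; first by rewrite /t2; lra.
  move=> x /andP[x0 xt2]; have [xsg|sgx] := ltP x sg; first by apply: lsg; rewrite x0.
  by apply: eP; move: xt2; rewrite /t2; lra.
move=> /(ub_le_sup ubE); rewrite -/sg /t2; lra.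
Qed.

End uniqueness.

(** * The Galerkin problem on a finite dimensional subspace *)

Section L2_product.
Context d (T : measurableType d) (R : realType) (mu : {measure set T -> \bar R}).
Implicit Types f g h k : LspaceType2 mu.

(** Almost everywhere equality identifies the underlying classes; what remains of the structure is a
    proof of a boolean fact, hence irrelevant. *)
Lemma Lspace_ae_inj f g : {ae mu, forall x, f x = g x} -> f = g.
Proof.
move=> fg; have /ae_eqP/eqP h : (f = g %[ae mu]) by apply: filterS fg => x + _.
have {h} : LebesgueSpace.sort f = LebesgueSpace.sort g.
  by move: h; rewrite /reverse_coercion !reprK.
case: f fg => f [[cf]]; case: g => g [[cg]] /= _ fg.
by rewrite {}fg in cf *; rewrite (bool_irrelevance cf cg).
Qed.

(* [f] takes its values in measurableTypeR R, whose measurable sets agree with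
   those of R although the two structures have different displays. *)
Lemma L2_measurable f : measurable_fun setT (f : T -> R).
Proof.
have fm : measurable_fun setT f by exact: measurable_funPT.
by move=> _ Y mY; exact: fm.
Qed.

Lemma L2_mul_integrable f g : mu.-integrable setT (EFin \o (fun x => f x * g x)).
Proof.
apply/Lfun1_integrable; apply: Lfun2_mul_Lfun1;
  (rewrite inE; apply/andP; split; rewrite inE /=;
    [exact: L2_measurable|exact: Lebesgue_finite]).
Qed.

(** Stated for a function [h] equal to the combination almost everywhere, since this is the form in
    which the linearity of [j] is given. *)
Lemma L2_mul_linear (a : R) f g h k : {ae mu, forall x, h x = a * f x + g x} ->
  \int[mu]_x (h x * k x) = a * \int[mu]_x (f x * k x) + \int[mu]_x (g x * k x).
Proof.
move=> hfg.
transitivity (\int[mu]_x (a * (f x * k x) + g x * k x)).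
  rewrite /Rintegral; congr fine; apply: ae_eq_integral => //.
  - by apply/measurable_EFinP; apply: measurable_funM; exact: L2_measurable.
  - apply/measurable_EFinP; apply: measurable_funD; last first.
      by apply: measurable_funM; exact: L2_measurable.
    apply: measurable_funM; first exact: measurable_cst.
    by apply: measurable_funM; exact: L2_measurable.
  - by apply: filterS hfg => x -> _ /=; rewrite mulrDl mulrA.
rewrite RintegralD//; last 2 first.
  - by have := integrableZl (measurableT) a (L2_mul_integrable f k).
  - exact: L2_mul_integrable.
by rewrite RintegralZl//; exact: L2_mul_integrable.
Qed.

Lemma L2_sqr_eq0 f : \int[mu]_x (f x * f x) = 0 -> {ae mu, forall x, f x = 0}.
Proof.
have fi := L2_mul_integrable f f.
rewrite /Rintegral => f0.
have : (\int[mu]_x `|(f x * f x)%:E| = 0)%E.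
  (* The real-valued integral is the [fine] part of an extended one and would also be 0 for an
     infinite value; integrability excludes this. *)
  rewrite -[RHS]/(0%:E) -f0 fineK; last exact: integrable_fin_num.
  by apply: eq_integral => x _; rewrite gee0_abs// lee_fin -expr2 sqr_ge0.
move=> /ae_eq_integral_abs; case => //.
  by apply/measurable_EFinP; apply: measurable_funM; exact: L2_measurable.
move=> A [mA A0 H]; exists A; split => // x nx; apply: H => /= h; apply: nx.
by have [/eqP] := h I; rewrite mulf_eq0 orbb => /eqP.
Qed.

End L2_product.

Section function_space_dot.
Variables (R : realType) (N : nat) (Omega : set 'rV[R]_N) (mOmega : measurable Omega).
Variables (V : tvsType R) (j : V -> L2 mOmega).
Hypothesis Vj : function_space j.
Implicit Types (a : R) (u v w : V).

Lemma L2_dotC u v : L2_dot (j u) (j v) = L2_dot (j v) (j u).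
Proof. by rewrite /L2_dot; apply: eq_Rintegral => x _; rewrite mulrC. Qed.

Lemma L2_dot_linear a u v w :
  L2_dot (j (a *: u + v)) (j w) = a * L2_dot (j u) (j w) + L2_dot (j v) (j w).
Proof. exact: L2_mul_linear (function_space_linear Vj a u v). Qed.

Lemma L2_dot_eq0 u : L2_dot (j u) (j u) = 0 -> u = 0.
Proof.
move=> /L2_sqr_eq0 u0; apply: (function_space_inj Vj); apply: Lspace_ae_inj.
(* As [j] is linear only almost everywhere, the vanishing of [j 0] is read off from the combination
   [- u + u]. *)
have := function_space_linear Vj (-1) u u; rewrite scaleN1r addNr.
by apply: filterS2 u0 => x -> ->; rewrite mulr0 addr0.
Qed.

End function_space_dot.

(** * Linear combinations and coordinates *)

Section lincomb.
Variables (R : realType) (V : tvsType R).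

(** The coefficients form a row vector so that they live in the normed space in which the
    differential equation is solved. *)
Definition lincomb (n : nat) (e : 'I_n -> V) (c : 'rV[R]_n) : V :=
  \sum_(i < n) c 0 i *: e i.

Definition lfree (n : nat) (e : 'I_n -> V) := forall c, lincomb e c = 0 -> c = 0.

Section fixed_family.
Variables (n : nat) (e : 'I_n -> V).
Local Notation lc := (lincomb e).

Lemma lincombB c d : lc (c - d) = lc c - lc d.
Proof. by rewrite /lincomb -sumrB; apply: eq_bigr => i _; rewrite !mxE scalerBl. Qed.

Lemma lincombD c d : lc (c + d) = lc c + lc d.
Proof. by rewrite /lincomb -big_split; apply: eq_bigr => i _; rewrite !mxE scalerDl. Qed.

Lemma lincombZ a c : lc (a *: c) = a *: lc c.
Proof. by rewrite /lincomb scaler_sumr; apply: eq_bigr => i _; rewrite !mxE scalerA. Qed.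

Lemma lincomb0 : lc 0 = 0.
Proof. by rewrite -(scale0r (0 : 'rV[R]_n)) lincombZ scale0r. Qed.

Lemma lincomb_delta i : lc (delta_mx 0 i) = e i.
Proof.
rewrite /lincomb (bigD1 i)//= mxE !eqxx scale1r big1 ?addr0// => k ki.
by rewrite mxE (negPf ki) andbF scale0r.
Qed.

Lemma lincomb_inj : lfree e -> injective lc.
Proof.
move=> ef c d cd; apply/eqP; rewrite -subr_eq0; apply/eqP; apply: ef.
by rewrite lincombB cd subrr.
Qed.

End fixed_family.

Lemma cvg_sum_tvs (T : Type) (FF : set_system T) (I : Type) (r : seq I)
    (f : I -> T -> V) (l : I -> V) :
  Filter FF -> (forall i, f i x @[x --> FF] --> l i) ->
  \sum_(i <- r) f i x @[x --> FF] --> \sum_(i <- r) l i.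
Proof.
move=> F fl; elim: r => [|i r IH].
  rewrite big_nil; under eq_fun do rewrite big_nil; exact: cvg_cst.
rewrite big_cons; under eq_fun do rewrite big_cons.
exact: (cvg_comp2 (fl i) IH (add_continuous (l i, \sum_(k <- r) l k))).
Qed.

Lemma lincomb_continuous n (e : 'I_n -> V) : continuous (lincomb e).
Proof.
move=> c; apply: (cvg_sum_tvs (nbhs_filter c)) => i.
apply: (cvg_comp2 _ (cvg_cst (e i)) (scale_continuous (c 0 i : R^o, e i))).
exact: coord_continuous.
Qed.

(** Extraction of a basis by induction on the list: a vector is dropped when it depends on the basis
    already found, and adjoined otherwise. *)
Lemma lspan_free (s : seq V) :
  exists n (e : 'I_n -> V), lfree e /\ lspan s = range (lincomb e).
Proof.
elim: s => [|x s [n [e [ef se]]]].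
  exists 0%N, (fun=> 0); split; first by move=> c _; apply/rowP => -[].
  apply/seteqP; split => v /=.
    by move=> [c ->]; exists 0 => //; rewrite /lincomb !big_ord0.
  by move=> [c _ <-]; exists (fun=> 0); rewrite /lincomb !big_ord0.
have spanE v : lspan (x :: s) v <-> exists a c, v = a *: x + lincomb e c.
  split.
    move=> [c ->]; rewrite big_ord_recl/=.
    have : lspan s (\sum_(i < size s) c (lift ord0 i) *: s`_i).
      by exists (fun i => c (lift ord0 i)).
    by rewrite se => -[d _ dE]; exists (c ord0), d; rewrite dE.
  move=> [a [d ->]]; have : lspan s (lincomb e d) by rewrite se; exists d.
  move=> [c ->].
  exists (fun i => if unlift ord0 i is Some k then c k else a).
  rewrite big_ord_recl/= unlift_none; congr (_ + _); apply: eq_bigr => i _.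
  by rewrite liftK.
have [[d _ dx]|nx] := pselect (range (lincomb e) x).
  exists n, e; split => //; apply/seteqP; split => v.
    move=> /spanE[a [c ->]]; exists (a *: d + c) => //.
    by rewrite lincombD lincombZ dx.
  by move=> [c _ <-]; apply/spanE; exists 0, c; rewrite scale0r add0r.
pose e' (i : 'I_n.+1) := if unlift ord0 i is Some k then e k else x.
have e'E (c : 'rV[R]_n.+1) :
    lincomb e' c = c 0 ord0 *: x + lincomb e (\row_i c 0 (lift ord0 i)).
  rewrite /lincomb big_ord_recl /e' unlift_none; congr (_ + _).
  by apply: eq_bigr => i _; rewrite liftK mxE.
exists n.+1, e'; split.
  move=> c; rewrite e'E => c0.
  have c00 : c 0 ord0 = 0.
    apply: contrapT => /eqP cn; apply: nx.
    exists (- (c 0 ord0)^-1 *: \row_i c 0 (lift ord0 i)) => //.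
    move/eqP : c0; rewrite addrC addr_eq0 lincombZ => /eqP ->.
    by rewrite scalerN scaleNr opprK scalerA mulVf// scale1r.
  move: c0; rewrite c00 scale0r add0r => /ef /rowP c0.
  apply/rowP => i; rewrite mxE; case: (unliftP ord0 i) => [k ->|->//].
  by have := c0 k; rewrite !mxE.
apply/seteqP; split => v.
  move=> /spanE[a [c ->]].
  exists (\row_i if unlift ord0 i is Some k then c 0 k else a) => //.
  rewrite e'E mxE unlift_none; congr (_ + lincomb e _).
  by apply/rowP => i; rewrite !mxE liftK.
by move=> [c _ <-]; apply/spanE; rewrite e'E; eexists; eexists.
Qed.

Section coordinates.
Hypothesis hV : hausdorff_space V.
Variables (n : nat) (e : 'I_n -> V).
Hypothesis ef : lfree e.
Local Notation lc := (lincomb e).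

(* The image of the unit sphere is compact, hence closed, and misses 0. *)
Lemma lincomb_norm_bounded : exists W M, [/\ nbhs (0 : V) W, 0 < M &
  forall c, W (lc c) -> `|c| <= M].
Proof.
pose S := [set c : 'rV[R]_n | `|c| = 1].
have cS : compact S.
  apply: bounded_closed_compact.
    exists 1; split => // x x1 c /= ->; exact: ltW.
  apply: (@closed_comp _ _ (fun c : 'rV[R]_n => `|c|) [set x | x = 1]).
    by move=> c _; exact: norm_continuous.
  exact: closed_eq.
have cK : closed (lc @` S).
  apply: compact_closed => //; apply: continuous_compact => //.
  by apply: continuous_subspaceT; exact: lincomb_continuous.
have K0 : nbhs (0 : V) (~` (lc @` S)).
  apply: open_nbhs_nbhs; split; first exact: closed_openC.
  move=> [c c1]; rewrite -(lincomb0 e) => /(lincomb_inj ef) c0.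
  by move: c1; rewrite /S/= c0 normr0 => /esym/eqP; rewrite oner_eq0.
(* Continuity of scaling at (0, 0) yields [d] and [W] such that no multiple of a vector of [W] by a
   scalar below [d] meets the image of the sphere. If [|c| > 2 / d] and [lc c] were in [W],
   normalising [c] would produce such a multiple. *)
have := @scale_continuous _ V (0 : R^o, 0 : V) (~` (lc @` S)).
rewrite /= scale0r => /(_ K0) [[B W]] /= [/nbhs_ballP[d /= d0 dB] nW] BW.
exists W, (2 / d); split => //; first by rewrite divr_gt0.
move=> c Wc; rewrite leNgt; apply/negP => cd.
have c0 : 0 < `|c| by apply: lt_trans cd; rewrite divr_gt0.
apply: (BW (`|c|^-1, lc c)).
  split => //=; apply: dB; rewrite /ball/= sub0r normrN gtr0_norm ?invr_gt0//.
  rewrite invf_plt ?posrE//; apply: lt_trans cd.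
  by rewrite ltr_pdivlMr// mulVf ?gt_eqF// ltr1n.
exists (`|c|^-1 *: c); last by rewrite lincombZ.
by rewrite /S/= normrZ normfV normr_id mulVf// gt_eqF.
Qed.

(** The inverse of [lc] is continuous: once [lc (g x) - lc p] lies in [(d / M) W], rescaling by
    [M / d] and the bound [M] on [W] give [|g x - p| <= d]. *)
Lemma lincomb_cvg (T : Type) (FF : set_system T) (g : T -> 'rV[R]_n) (p : 'rV[R]_n) :
  Filter FF -> lc (g x) @[x --> FF] --> lc p -> g x @[x --> FF] --> p.
Proof.
move=> F gp; have [W [M [nW M0 WM]]] := lincomb_norm_bounded.
apply/cvgrPdist_le => d d0 /=.
have dM : d / M != 0 by rewrite gt_eqF// divr_gt0.
have H : \forall x \near FF, [set lc p + x | x in [set (d / M) *: x | x in W]] (lc (g x)).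
  exact: gp _ (nbhsT (lc p) (nbhs0Z dM nW)).
apply: filterS H => x [_ [w Ww <-]] wE.
have : W (lc ((M / d) *: (g x - p))).
  rewrite lincombZ lincombB -wE addrC addKr scalerA.
  have -> : M / d * (d / M) = 1 by field; rewrite !gt_eqF.
  by rewrite scale1r.
move=> /WM; rewrite normrZ gtr0_norm ?divr_gt0// distrC => h.
by move: h; rewrite mulrAC ler_pdivrMr// ler_pM2l.
Qed.

Lemma diff_quotient_lincomb (s t : R) (c : R -> 'rV[R]_n) (p : 'rV[R]_n) :
  diff_quotient s (fun t => lc (c t)) t --> lc p <-> diff_quotient s c t --> p.
Proof.
rewrite /diff_quotient.
under eq_fun do rewrite -lincombB -lincombZ.
split; first exact: lincomb_cvg.
by move=> cp; apply: (cvg_comp _ _ cp); exact: lincomb_continuous.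
Qed.

End coordinates.

End lincomb.

Lemma diff_quotient_ext (R : realType) (V : tvsType R) (s t : R) (u v : R -> V) (p : V) :
  0 <= t < s -> (forall t, 0 <= t < s -> u t = v t) ->
  diff_quotient s u t --> p -> diff_quotient s v t --> p.
Proof.
move=> ts uv; apply: cvg_trans; apply: near_eq_cvg; rewrite near_withinE.
by near=> h => hs; rewrite !uv.
Unshelve. all: by end_near. Qed.

(** * Time derivatives in V *)

Section time_derivative.
Variables (R : realType) (V : tvsType R).
Implicit Types (s t : R) (u : R -> V) (p : V).

(** Small positive increments are admissible at every time, 0 included. Properness is what makes the
    limit of the quotient, hence [time_deriv], unique in a Hausdorff space. *)
Lemma diff_quotient_proper s t : 0 <= t < s ->
  ProperFilter (within [set h | 0 <= t + h < s] 0^').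
Proof.
move=> /andP[t0 ts]; apply: Build_ProperFilter_ex => P.
rewrite /within/= => /nbhs_ballP[e /= e0 eP].
pose h := Num.min e (s - t) / 2.
have m0 : 0 < Num.min e (s - t) by rewrite lt_min e0 subr_gt0.
have me : Num.min e (s - t) <= e by rewrite ge_min lexx.
have ms : Num.min e (s - t) <= s - t by rewrite ge_min lexx orbT.
exists h; apply: eP; rewrite /ball/= ?sub0r ?normrN /h.
- by rewrite gtr0_norm; lra.
- by rewrite gt_eqF; lra.
- lra.
Qed.

Lemma time_derivE s t u p : hausdorff_space V -> 0 <= t < s ->
  diff_quotient s u t --> p -> time_deriv s u t = p.
Proof.
move=> hV ts up; have FF := diff_quotient_proper ts.
have := @xgetPex _ 0 [set p | diff_quotient s u t --> p] (ex_intro _ p up).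
by move=> up'; apply: (@cvg_unique _ hV (diff_quotient s u t)).
Qed.

Lemma diff_quotient_le s s' t u p : s <= s' ->
  diff_quotient s' u t --> p -> diff_quotient s u t --> p.
Proof.
move=> ss'; apply: cvg_trans; apply: cvg_app => P P0.
have : \forall h \near 0^', 0 <= t + h < s' -> P h by exact: P0.
by apply: filterS => h Ph /andP[h0 hs]; apply: Ph; rewrite h0 (lt_le_trans hs).
Qed.

End time_derivative.

(** * The Galerkin system in coordinates *)

Section galerkin.
Variables (R : realType) (N : nat) (Omega : set 'rV[R]_N) (mOmega : measurable Omega).
Variables (V : tvsType R) (j : V -> L2 mOmega).
Hypothesis Vj : function_space j.
Variable (A : V -> tdual V).

(** Only differentiability is recorded; continuity of the derivative is delivered separately, as
    [C_k 1], by the existence lemmas. *)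
Definition galerkin_solution (W : set V) (s : R) (u : R -> V) :=
  derivable_on s u /\ forall t, 0 <= t < s ->
    [/\ W (u t), W (time_deriv s u t) &
      forall v, W v -> L2_dot (j (time_deriv s u t)) (j v) = pairing (A (u t)) v].

Section coordinates.
Variables (n : nat) (e : 'I_n -> V).
Hypothesis ef : lfree e.
Local Notation lc := (lincomb e).
Hypothesis A_lip : locally_lipschitz_on (range lc) A.

Let hV : hausdorff_space V := function_space_hausdorff Vj.

Lemma L2_dot_lincomb c w :
  L2_dot (j (lc c)) (j w) = \sum_(i < n) c 0 i * L2_dot (j (e i)) (j w).
Proof.
have dot0 : L2_dot (j 0) (j w) = 0.
  by have := L2_dot_linear Vj (-1) 0 0 w; rewrite scaler0 addr0 mulN1r addNr.
rewrite /lincomb; elim/big_rec2 : _ => [//|i y x _ <-].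
exact: L2_dot_linear.
Qed.

Definition gram : 'M[R]_n := \matrix_(i, k) L2_dot (j (e i)) (j (e k)).

Lemma mulmx_gram c k : (c *m gram) 0 k = L2_dot (j (lc c)) (j (e k)).
Proof. by rewrite L2_dot_lincomb mxE; apply: eq_bigr => i _; rewrite mxE. Qed.

(** A row vector killed by the Gram matrix combines to an element of V orthogonal to itself, which
    is 0 as the inner product is definite and [j] injective; freeness then kills the
    coefficients. *)
Lemma gram_unit : gram \in unitmx.
Proof.
rewrite -row_free_unit; apply: inj_row_free => c cG; apply: ef.
apply: (L2_dot_eq0 Vj); rewrite L2_dot_lincomb big1// => i _.
by rewrite L2_dotC -mulmx_gram cG mxE mulr0.
Qed.

(** Coordinates of the element of the span that represents the functional [A x] for the L^2
    product. *)
Definition galerkin_field (x : V) : 'rV[R]_n :=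
  (\row_k pairing (A x) (e k)) *m invmx gram.

Lemma galerkin_fieldP x d :
  (forall v, range lc v -> L2_dot (j (lc d)) (j v) = pairing (A x) v) <->
  d = galerkin_field x.
Proof.
split=> [H|].
  rewrite /galerkin_field -[LHS](mulmxK gram_unit); congr (_ *m _).
  apply/rowP => k; rewrite mulmx_gram H ?mxE//.
  by exists (delta_mx 0 k) => //; exact: lincomb_delta.
move=> -> v [c _ <-]; rewrite L2_dotC L2_dot_lincomb.
rewrite /pairing /lincomb linear_sum; apply: eq_bigr => k _.
rewrite linearZ/= L2_dotC -mulmx_gram /galerkin_field mulmxKV ?gram_unit//.
by rewrite mxE.
Qed.

(** The Lipschitz condition on [A] is uniform over a bounded set of test vectors; the basis is the
    bounded set to which it is applied. *)
Lemma tvs_bounded_range : tvs_bounded (range e).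
Proof.
move=> W W0.
have : \forall a \near (0 : R^o), forall i, W (a *: e i).
  apply: (@filter_forall R^o 'I_n (fun i a => W (a *: e i)) (nbhs (0 : R^o)) _) => i.
  have ci : (a : R^o) *: e i @[a --> (0 : R^o)] --> (0 : R^o) *: e i.
    apply: (cvg_comp2 _ (cvg_cst (e i)) (scale_continuous (0 : R^o, e i))).
    exact: cvg_id.
  by apply: ci; rewrite scale0r.
move=> /nbhs_ballP[d /= d0 dP]; have d2 : 0 < d / 2 by rewrite divr_gt0.
exists (d / 2)^-1; first by rewrite invr_gt0.
move=> _ [i _ <-]; exists ((d / 2) *: e i).
  by apply: dP; rewrite /ball/= sub0r normrN gtr0_norm//; lra.
by rewrite scalerA mulVf ?gt_eqF// scale1r.
Qed.

Lemma galerkin_field_lipschitz c0 : exists r K, [/\ 0 < r, 0 <= K &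
  forall x y, `|x - c0| <= r -> `|y - c0| <= r ->
    `|galerkin_field (lc x) - galerkin_field (lc y)| <= K * `|x - y|].
Proof.
have [|O [q [nO [qD qZ _] H]]] := A_lip tvs_bounded_range (w := lc c0).
  by exists c0.
have /nbhs_ballP[r /= r0 rP] := lincomb_continuous nO.
(* [Q] bounds the seminorm of [lc x] by the norm of [x], and [C], the sum of all entries in absolute
   value, bounds multiplication by the inverse Gram matrix. *)
pose Q := \sum_(i < n) `|q (e i)|.
pose C := \sum_(i < n) \sum_(k < n) `|invmx gram k i|.
have Q0 : 0 <= Q by exact: sumr_ge0.
have C0 : 0 <= C by apply: sumr_ge0 => i _; exact: sumr_ge0.
exists (r / 2), (Q * C); split; [by rewrite divr_gt0|by rewrite mulr_ge0|].
have inO x : `|x - c0| <= r / 2 -> O (lc x).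
  by move=> xr; apply: rP; rewrite -ball_normE /ball_/= distrC; move: r0; lra.
have qlc x : q (lc x) <= Q * `|x|.
  have q0 : q 0 = 0 by rewrite -(scale0r (0 : V)) qZ normr0 mul0r.
  rewrite /lincomb /Q mulr_suml; elim/big_ind2 : _ => [|u a v b ua vb|i _].
  - by rewrite q0.
  - by rewrite (le_trans (qD _ _))// lerD.
  - rewrite qZ mulrC (le_trans (ler_norm _))// normrM normr_id.
    by rewrite ler_wpM2l// coord_le_rV_norm.
move=> x y xr yr.
have bxy k : `|pairing (A (lc x)) (e k) - pairing (A (lc y)) (e k)| <= Q * `|x - y|.
  apply: le_trans (qlc (x - y)); rewrite lincombB.
  by apply: H => //; [split; [exists x|exact: inO]|split; [exists y|exact: inO]].
rewrite /galerkin_field -mulmxBl.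
apply: rV_norm_le => [|i]; first by rewrite !mulr_ge0.
rewrite mxE (le_trans (ler_norm_sum _ _ _))//.
apply: (@le_trans _ _ (\sum_(k < n) (Q * `|x - y|) * `|invmx gram k i|)).
  by apply: ler_sum => k _; rewrite normrM ler_wpM2r// !mxE.
rewrite -mulr_sumr mulrAC ler_wpM2r// ler_wpM2l//.
rewrite /C [leRHS](bigD1 i)//= lerDl; apply: sumr_ge0 => k _; exact: sumr_ge0.
Qed.

(** Turns any competitor in V into a solution of the ordinary differential equation, so that
    [ode_uniqueness] applies. The coordinates are chosen time by time; their differentiability comes
    from [diff_quotient_lincomb]. *)
Lemma galerkin_coordinates s u : galerkin_solution (range lc) s u ->
  exists c, forall t, 0 <= t < s ->
    u t = lc (c t) /\ diff_quotient s c t --> galerkin_field (lc (c t)).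
Proof.
move=> [du uP].
have /choice[c cP] : forall t, exists ct, 0 <= t < s -> lc ct = u t.
  move=> t; have [ts|] := boolP (0 <= t < s); last by exists 0.
  by have [[ct _ ctE] _ _] := uP t ts; exists ct.
exists c => t ts; split; first by rewrite cP.
have [p dp] := du t ts.
have [_ + ueq] := uP t ts; rewrite (time_derivE hV ts dp) in ueq *.
move=> [d _ dE]; rewrite -dE in ueq dp; rewrite -(cP t ts) in ueq.
move/galerkin_fieldP : ueq => <-.
apply/(diff_quotient_lincomb hV ef).
by apply: (diff_quotient_ext ts _ dp) => t' ts'; rewrite cP.
Qed.

Lemma galerkin_existence (T : R) (c0 : 'rV[R]_n) : 0 < T ->
  exists s u, [/\ 0 < s <= T, u 0 = lc c0, galerkin_solution (range lc) s u, C_k 1 s u &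
    forall w, galerkin_solution (range lc) s w -> w 0 = u 0 ->
      forall t, 0 <= t < s -> w t = u t].
Proof.
move=> T0; have [r [K [r0 K0 Flip]]] := galerkin_field_lipschitz c0.
have [c [c00 cP]] := picard_existence r0 K0 Flip.
have := picard_time_gt0 (fun x => galerkin_field (lc x)) c0 r0 K0.
set s0 := picard_time _ _ _ _ in cP * => s00.
pose s := Num.min s0 T.
have s_gt0 : 0 < s by rewrite lt_min s00.
have ss0 : s <= s0 by rewrite ge_min lexx.
have tss0 t : 0 <= t < s -> 0 <= t < s0.
  by move=> /andP[-> /lt_le_trans]; exact.
pose u t := lc (c t).
have cF t : 0 <= t < s -> diff_quotient s c t --> galerkin_field (lc (c t)).
  by move=> ts; apply: diff_quotient_le ss0 _; exact: (cP _ (tss0 _ ts)).2.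
have du t : 0 <= t < s -> diff_quotient s u t --> lc (galerkin_field (u t)).
  by move=> ts; apply/(diff_quotient_lincomb hV ef); exact: cF.
have tdE t : 0 <= t < s -> time_deriv s u t = lc (galerkin_field (u t)).
  by move=> ts; apply: time_derivE => //; exact: du.
have dons : derivable_on s u by move=> t ts; eexists; exact: du.
exists s, u; split.
- by rewrite s_gt0 ge_min lexx orbT.
- by rewrite /u c00.
- split => // t ts; rewrite tdE//; split; first by exists (c t).
    by exists (galerkin_field (u t)).
  exact/galerkin_fieldP.
(* On [[0, s)] the derivative equals [lc (galerkin_field (u t))], continuous since the field is
   Lipschitz on the ball containing the coordinates [c]. *)
- split => //=; apply/subspace_continuousP => t /= ts.
  rewrite /from_subspace tdE//.
  apply: (@cvg_trans _
    (lc (galerkin_field (u x)) @[x --> within [set t | 0 <= t < s] (nbhs t)])).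
    by apply: near_eq_cvg; rewrite near_withinE; near=> x => xs; rewrite tdE.
  apply: (cvg_comp _ lc _ (@lincomb_continuous _ _ _ e _)).
  apply/cvgrPdist_le => eps eps0.
  have eK : 0 < eps / (K + 1) by rewrite divr_gt0 ?ltr_wpDl.
  have [d d0 dP] := diff_quotient_continuous (cF t ts) eK.
  rewrite near_withinE; apply/nbhs_ballP; exists d => //= x; rewrite /ball/= distrC => xd xs.
  have inb y : 0 <= y < s -> `|c y - c0| <= r.
    by move=> /tss0/cP[+ _] => /le_trans; apply; move: r0; lra.
  rewrite (le_trans (Flip _ _ _ _)) ?inb// distrC.
  have := dP x xd xs; rewrite ler_pdivlMr ?ltr_wpDl// => h.
  by apply: le_trans h; rewrite mulrC ler_wpM2l//; lra.
- move=> w /galerkin_coordinates[d dP] w0 t ts.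
  have z0s : 0 <= (0 : R) < s by rewrite lexx.
  rewrite (dP t ts).1; congr (lc _).
  apply: (ode_uniqueness r0 K0 Flip (s := s) (c := d) (d := c)) => //.
  + by move=> x xs; exact: (dP x xs).2.
  + by apply: (lincomb_inj ef); rewrite -(dP 0 z0s).1 w0.
  + by move=> x xs; exact: (cP _ (tss0 _ xs)).1.
Unshelve. all: by end_near. Qed.

End coordinates.

Lemma galerkin_cauchy_problem (W : set V) (T : R) (u0 : V) :
  finite_dim_subspace W -> locally_lipschitz_on W A -> 0 < T -> W u0 ->
  exists s u, [/\ 0 < s <= T, u 0 = u0, galerkin_solution W s u, C_k 1 s u &
    forall w, galerkin_solution W s w -> w 0 = u0 ->
      forall t, 0 <= t < s -> w t = u t].
Proof.
move=> [l ->]; have [n [e [ef ->]]] := lspan_free l.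
move=> Alip T0 [c0 _ <-].
have [s [u [sT u0E us uC uu]]] := galerkin_existence ef Alip c0 T0.
by exists s, u; split => // w ws w0; apply: uu => //; rewrite w0.
Qed.

End galerkin.

(** * Passage to the Lambda-limit *)

Section transfer.
Variables (L : Type) (U : set_system L).
Hypothesis FU : Filter U.

Lemma star_rel_ulimP (X Y : Type) (r : X -> Y -> Prop) (phi : L -> X) (psi : L -> Y) :
  star_rel r (ulim U phi) (ulim U psi) -> \forall l \near U, r (phi l) (psi l).
Proof.
move=> [p [q [/(ulimP FU) ep /(ulimP FU) eq rpq]]].
by apply: filterS2 ep eq => l -> ->.
Qed.

Lemma ulim_set_ulimP (X : Type) (B : L -> set X) (phi : L -> X) :
  ulim_set U B (ulim U phi) -> \forall l \near U, B l (phi l).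
Proof.
move=> [psi Bpsi /(ulimP FU) e].
by apply: filterS e => l ->.
Qed.

(** Membership in a limit set asks for a representative that is good at every index; nonemptiness
    allows [phi] to be corrected at the bad ones without changing its class. *)
Lemma ulim_set_near (X : Type) (B : L -> set X) (phi : L -> X) :
  (forall l, B l !=set0) -> (\forall l \near U, B l (phi l)) -> ulim_set U B (ulim U phi).
Proof.
move=> /choice[b Bb] Bphi.
exists (fun l => if pselect (B l (phi l)) then phi l else b l).
  by move=> l; case: pselect.
by apply/(ulimP FU); apply: filterS Bphi => l; case: pselect.
Qed.

(** Transfer of a universal quantifier. At each index a counterexample is chosen if there is one,
    and any element of [D l] otherwise; the hypothesis on this single net shows that counterexamples
    are absent for almost every index. *)
Lemma near_forall_choice (X : Type) (P : L -> X -> Prop) (D : L -> set X) :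
  (forall l, D l !=set0) ->
  (forall x : L -> X, (forall l, D l (x l)) -> \forall l \near U, P l (x l)) ->
  \forall l \near U, forall x, D l x -> P l x.
Proof.
move=> D0 H.
have /choice[x xP] : forall l, exists x, D l x /\ ((exists y, D l y /\ ~ P l y) -> ~ P l x).
  move=> l; have [[y [Dy nP]]|h] := pselect (exists y, D l y /\ ~ P l y).
    by exists y.
  by have [y Dy] := D0 l; exists y.
have := H x (fun l => (xP l).1); apply: filterS => l Px y Dy.
by apply: contrapT => nP; apply: (xP l).2 Px; exists y.
Qed.

End transfer.

(** * Generalized solutions as limits of Galerkin solutions *)

Section GUS.
Variables (R : realType) (U : set_system (Lindex R)).
Hypothesis FU : Filter U.
Variables (N : nat) (Omega : set 'rV[R]_N) (mOmega : measurable Omega).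
Variables (V : tvsType R) (j : V -> L2 mOmega).
Variables (Vl : Lindex R -> set V) (A : V -> tdual V).
Hypothesis Vl0 : forall l, Vl l !=set0.
Variable s : Lindex R -> R.
Hypothesis s_gt0 : forall l, 0 < s l.

Lemma star_co_ulimP (t : Lindex R -> R) : star_co (ulim U s) (ulim U t) ->
  \forall l \near U, 0 <= t l < s l.
Proof.
move=> [/(star_rel_ulimP FU) t0 /(star_rel_ulimP FU) ts].
by apply: filterS2 t0 ts => l -> ->.
Qed.

Lemma star_co_ulim (t : Lindex R -> R) : (forall l, 0 <= t l < s l) ->
  star_co (ulim U s) (ulim U t).
Proof.
move=> ts; split.
  by exists (fun=> 0), t; split => // l; case/andP: (ts l).
by exists t, s; split => // l; case/andP: (ts l).
Qed.

Lemma star_time_deriv_ulim i (u : Lindex R -> R -> V) (t : Lindex R -> R) :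
  star_app (star_time_deriv i (ulim U s) (ulim U u)) (ulim U t) =
  ulim U (fun l => iter i (time_deriv (s l)) (u l) (t l)).
Proof. by rewrite /star_app /star_time_deriv !(star2E FU). Qed.

Lemma star_app_ulim (u : Lindex R -> R -> V) (t : Lindex R -> R) :
  star_app (ulim U u) (ulim U t) = ulim U (fun l => u l (t l)).
Proof. exact: star2E. Qed.

Lemma GUS_ulim (u : Lindex R -> R -> V) (u0 : Lindex R -> V) :
  (forall l, galerkin_solution j A (Vl l) (s l) (u l)) -> (forall l, C_k 1 (s l) (u l)) ->
  (forall l, u l 0 = u0 l) ->
  is_GUS j Vl A (ulim U u0) (ulim U s) (ulim U u).
Proof.
move=> us uC u00; split.
- split; first by exists s => //; exists u.
  move=> i t i1; rewrite -[t](net_ofK t); set tau := net_of t => /star_co_ulimP ts.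
  rewrite star_time_deriv_ulim; apply: ulim_set_near => //.
  apply: filterS ts => l ts; have [h0 h1 _] := (us l).2 _ ts.
  by case: i i1 => [|[|//]] _.
- move=> v t; rewrite -[t](net_ofK t) -[v](net_ofK v).
  set tau := net_of t; set nu := net_of v => /(ulim_set_ulimP FU) Vv /star_co_ulimP ts.
  rewrite star_time_deriv_ulim star_app_ulim /star_dot /star_pairing (star1E FU) !(star2E FU).
  apply/(ulimP FU); apply: filterS2 Vv ts => l Vv ts.
  by have [_ _ ->] := (us l).2 _ ts.
- by rewrite star_app_ulim; apply/(ulimP FU); apply: filterE.
Qed.

Lemma GUS_galerkin (w : star U (R -> V)) (u0 : Lindex R -> V) :
  is_GUS j Vl A (ulim U u0) (ulim U s) w ->
  exists2 omega, w = ulim U omega & \forall l \near U,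
    galerkin_solution j A (Vl l) (s l) (omega l) /\ omega l 0 = u0 l.
Proof.
(* The regularity of [w] comes with its own net [s'] of end points, which agrees with [s] only
   almost everywhere; [ss'] reconciles the two at the end. *)
move=> [[[s' /(ulimP FU) ss' [omega oC ->]] oV] oeq o0]; exists omega => //.
have co0 l : [set t | 0 <= t < s l] !=set0 by exists 0; rewrite /= lexx s_gt0.
have H0 : \forall l \near U, forall t, 0 <= t < s l -> Vl l (omega l t).
  apply: (near_forall_choice FU co0) => t /star_co_ulim ts.
  have := oV 0%N _ isT ts; rewrite star_time_deriv_ulim.
  exact: ulim_set_ulimP.
have H1 : \forall l \near U, forall t, 0 <= t < s l -> Vl l (time_deriv (s l) (omega l) t).
  apply: (near_forall_choice FU co0) => t /star_co_ulim ts.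
  have := oV 1%N _ isT ts; rewrite star_time_deriv_ulim.
  exact: ulim_set_ulimP.
(* Time and test vector are quantified as one pair, so that a single choice of counterexamples
   handles both. *)
have H2 : \forall l \near U, forall tv : R * V, 0 <= tv.1 < s l /\ Vl l tv.2 ->
    L2_dot (j (time_deriv (s l) (omega l) tv.1)) (j tv.2) = pairing (A (omega l tv.1)) tv.2.
  pose D l := [set tv : R * V | 0 <= tv.1 < s l /\ Vl l tv.2].
  apply: (near_forall_choice FU (D := D)) => [l|tv tvP].
    by have [v Vv] := Vl0 l; exists (0, v); rewrite /D/= lexx s_gt0.
  have ts := star_co_ulim (fun l => (tvP l).1).
  have Vv : ultrafunctions U Vl (ulim U (fun l => (tv l).2)).
    by exists (fun l => (tv l).2) => // l; exact: (tvP l).2.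
  have := oeq _ _ Vv ts; rewrite star_time_deriv_ulim star_app_ulim.
  by rewrite /star_dot /star_pairing (star1E FU) !(star2E FU) => /(ulimP FU).
have {o0}H3 : \forall l \near U, omega l 0 = u0 l.
  by move: o0; rewrite star_app_ulim => /(ulimP FU).
apply: filterS (filterI ss' (filterI H0 (filterI H1 (filterI H2 H3)))).
move=> l [ss'l [h0 [h1 [h2 h3]]]]; split => //; split.
  by have [] := oC l; rewrite ss'l.
by move=> t ts; split; [exact: h0|exact: h1|move=> v Vv; exact: (h2 (t, v))].
Qed.

End GUS.

Theorem theorem38 (R : realType)
    (U : set_system (Lindex R)) (ultraU : UltraFilter U) (fineU : fine_filter U)
    (N : nat) (Omega : set 'rV[R]_N) (mOmega : measurable Omega)
    (V : tvsType R) (j : V -> L2 mOmega) (Vj : function_space j)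
    (Vl : Lindex R -> set V) (Vl_net : approximating_net Vl)
    (A : V -> tdual V) (A_lip : forall l, locally_lipschitz_on (Vl l) A)
    (T : R) (T_gt0 : 0 < T)
    (u0 : star U V) (u0_ultra : ultrafunctions U Vl u0) :
  exists S : star U R,
    [/\ std U 0 <* S, S <=* std U T &
      exists u : star U (R -> V), is_GUS j Vl A u0 S u /\
        forall w : star U (R -> V), is_GUS j Vl A u0 S w ->
          forall t, star_co S t -> star_app w t = star_app u t].
Proof.
have FU : Filter U by exact: (@ultra_proper _ _ ultraU).
(* The representative [f] of the initial datum lies in [Vl l] for every [l], so the Galerkin problem
   can be posed at each index. *)
have [f fV ->] := u0_ultra.
have /choice[s /choice[u su]] := fun l =>
  galerkin_cauchy_problem Vj (approximating_net_fin Vl_net l) (A_lip l) T_gt0 (fV l).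
have s0 l : 0 < s l by have [/andP[]] := su l.
have Vl0 l : Vl l !=set0 by exists (f l).
exists (ulim U s); split.
- by exists (fun=> 0), s.
- by exists s, (fun=> T); split => // l; have [/andP[]] := su l.
exists (ulim U u); split.
  have us l : galerkin_solution j A (Vl l) (s l) (u l).
    by have [_ _ h _ _] := su l; exact: h.
  have uC l : C_k 1 (s l) (u l).
    by have [_ _ _ h _] := su l; exact: h.
  have u0E l : u l 0 = f l.
    by have [_ h _ _ _] := su l; exact: h.
  exact: GUS_ulim us uC u0E.
move=> w /(GUS_galerkin FU Vl0 s0)[omega -> oP] t.
rewrite -[t](net_ofK t); set tau := net_of t => /(star_co_ulimP FU) ts.
rewrite !(star_app_ulim FU); apply/(ulimP FU).
apply: filterS2 oP ts => l [os o0] ts.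
by have [_ _ _ _ uniq] := su l; exact: uniq.
Qed.
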